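(* Let $q$ be a prime power, $n\ge 2$ an integer, and $a,b\in\mathbb{F}_q^{*}$. Let $\alpha,\beta\in\mathbb{F}_{q^n}$ be such that $\operatorname{N}(\alpha)=a$ and $\operatorname{Tr}(\beta)=b$. Let $X$ denote the non-singular projective curve defined over $\mathbb{F}_{q^n}$ given by the affine equation \[ y^q-y=\alpha x^{q-1}-\beta, \] and let $\#X(\mathbb{F}_{q^n})$ be the number of $\mathbb{F}_{q^n}$-rational points of $X$. Then \[ N_n(a,b)=\frac{\#X(\mathbb{F}_{q^n})-1}{q(q-1)}. \]
   Context: $\operatorname{N}$ and $\operatorname{Tr}$ denote the norm and trace maps from $\mathbb{F}_{q^n}$ to $\mathbb{F}_q$. For $a,b\in\mathbb{F}_q$, $N_n(a,b):=\#\{z\in\mathbb{F}_{q^n} : \operatorname{N}(z)=a,\ \operatorname{Tr}(z)=b\}$. The curve $X$ is the smooth projective model of the given affine Artin–Schreier equation; $\#X(\mathbb{F}_{q^n})$ counts all its rational points, including those at infinity. *)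

(* Defs.v *)
From HB Require Import structures.
From mathcomp Require Import all_boot all_order all_algebra all_fingroup all_field.
From mathcomp.multinomials Require Import mpoly.

Set Implicit Arguments.
Unset Strict Implicit.
Unset Printing Implicit Defensive.

Import GRing.Theory.
Local Open Scope ring_scope.

Section Evaluation.

Variables (k E : fieldType) (iota : {rmorphism k -> E}).

Definition evalmp m (P : 'rV[E]_m) (G : {mpoly k[m]}) : E :=
  mmap iota (fun i => P 0 i) G.

(* [P] gives homogeneous coordinates of an [E]-point of the projective
   algebraic set X in P^N cut out by the forms in the list [X]. *)
Definition on_locus N (X : seq {mpoly k[N.+1]}) (P : 'rV[E]_N.+1) : bool :=
  (P != 0) && all (fun G => evalmp P G == 0) X.

Definition jacobian N (X : seq {mpoly k[N.+1]}) (P : 'rV[E]_N.+1) :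
    'M[E]_(size X, N.+1) :=
  \matrix_(i, j) evalmp P (mderiv j X`_i).

End Evaluation.

Section Curves.

Variable k : fieldType.

Definition forms N (X : seq {mpoly k[N.+1]}) : Prop :=
  forall G, G \in X -> exists d, G \is d.-homog.

(* Jacobian criterion at all geometric points: the rank is the codimension
   N - 1 of a curve in P^N. Letting E range over all extension fields of k is
   the same as taking an algebraic closure of k. *)
Definition nonsingular_curve N (X : seq {mpoly k[N.+1]}) : Prop :=
  forall (E : fieldType) (iota : {rmorphism k -> E}) (P : 'rV[E]_N.+1),
    on_locus iota X P -> (\rank (jacobian iota X P) + 1)%N = N.

(* [w] is a generic point of the affine hypersurface f = 0 and K = k(w), i.e.
   K is the fraction field of k[X_1..X_m]/(f), with [w] the class of the
   variables. *)
Definition affine_function_field m (f : {mpoly k[m]})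
    (K : fieldType) (iota : {rmorphism k -> K}) (w : 'rV[K]_m) : Prop :=
  (forall G : {mpoly k[m]}, evalmp iota w G = 0 <-> exists H, G = H * f) /\
  (forall z : K, exists G H : {mpoly k[m]},
     evalmp iota w H != 0 /\ z = evalmp iota w G / evalmp iota w H).

(* X is irreducible with generic point [u] (any form vanishing at [u] vanishes
   on all geometric points of X) and K is the field of rational functions on X,
   i.e. of the quotients of forms of equal degree evaluated at [u]. *)
Definition proj_function_field N (X : seq {mpoly k[N.+1]})
    (K : fieldType) (iota : {rmorphism k -> K}) (u : 'rV[K]_N.+1) : Prop :=
  [/\ on_locus iota X u,
      (forall d (G : {mpoly k[N.+1]}), G \is d.-homog -> evalmp iota u G = 0 ->
         forall (E : fieldType) (jota : {rmorphism k -> E}) (P : 'rV[E]_N.+1),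
           on_locus jota X P -> evalmp jota P G = 0)
    & forall z : K, exists d (G H : {mpoly k[N.+1]}),
        [/\ G \is d.-homog, H \is d.-homog, evalmp iota u H != 0
          & z = evalmp iota u G / evalmp iota u H]].

Definition birational_to_affine m (f : {mpoly k[m]})
    N (X : seq {mpoly k[N.+1]}) : Prop :=
  exists (K : fieldType) (iota : {rmorphism k -> K})
         (w : 'rV[K]_m) (u : 'rV[K]_N.+1),
    affine_function_field f iota w /\ proj_function_field X iota u.

Definition nonsingular_projective_model (f : {mpoly k[2]})
    N (X : seq {mpoly k[N.+1]}) : Prop :=
  [/\ forms X, nonsingular_curve X & birational_to_affine f X].

(* (y^q - y) - (alpha x^(q-1) - beta), with x = 'X_0 and y = 'X_1 *)
Definition artin_schreier (q : nat) (alpha beta : k) : {mpoly k[2]} :=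
  let x := 'X_(0 : 'I_2) in let y := 'X_(1 : 'I_2) in
  (y ^+ q - y) - (alpha *: x ^+ q.-1 - beta%:MP).

End Curves.

(* A k-rational point of P^N is a line in k^(N+1); <<P>>%MS is the canonical
   matrix of the line spanned by P, so proportional coordinate vectors are
   counted once. *)
Definition rational_points (k : finFieldType) N (X : seq {mpoly k[N.+1]}) :
    {set 'M[k]_N.+1} :=
  [set <<P>>%MS | P in [set P : 'rV[k]_N.+1 | on_locus idfun X P]].

Section NormTrace.

(* finvect_type L is the field L with its finite type structure; every finite
   extension of F is of this form, and it is Galois over F. *)
Variables (F : finFieldType) (L : fieldExtType F).
Local Notation FL := (finvect_type L).

Definition normF (z : FL) : FL := galNorm 1 {:FL} z.
Definition traceF (z : FL) : FL := galTrace 1 {:FL} z.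

Definition count_norm_trace (a b : F) : nat :=
  #|[set z : FL | (normF z == a%:A) && (traceF z == b%:A)]|.

End NormTrace.

(* Main.v *)
Require Import Defs.
From HB Require Import structures.
From mathcomp Require Import all_boot all_order all_algebra all_fingroup all_field.
From mathcomp Require Import ring zify cyclic.
From mathcomp.multinomials Require Import mpoly.

Set Implicit Arguments.
Unset Strict Implicit.
Unset Printing Implicit Defensive.

Import GRing.Theory.
Local Open Scope ring_scope.

(** By Hilbert 90, multiplicative and additive, the fibres of
    [(x, y) |-> alpha x^(q-1)] from the affine curve to the set of elements of
    norm [a] and trace [b] all have [q (q - 1)] elements; so it remains to see
    that a nonsingular projective model [X] has exactly one rational point more
    than the affine curve.

    Both sides are compared with the rational places of the function field [K].
    The affine equation is smooth, and so is its single point at infinity, in the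
    coordinates [v = y / x], [s = 1 / x]. At a rational point of any nonsingular
    model, the Jacobian criterion and Cramer's rule make the maximal ideal of the
    local ring principal, say generated by [t]. The powers of [t] have trivial
    intersection because any two elements of [K] are algebraically dependent over
    [k], hence the local ring is a valuation ring. Conversely a place has a unique
    center on [X], since one can divide the homogeneous coordinates of the generic
    point by one of minimal valuation. *)

(** * Polynomial evaluation *)

Lemma mpoly_ring_ind (R : comNzRingType) m (Q : {mpoly R[m]} -> Prop) :
  (forall c, Q c%:MP) -> (forall i, Q 'X_i) ->
  (forall G H, Q G -> Q H -> Q (G + H)) ->
  (forall G H, Q G -> Q H -> Q (G * H)) -> forall G, Q G.
Proof.
move=> QC QX QD QM G; rewrite [G]mpolyE.
have Q0 : Q 0 by rewrite -(mpolyC0 m R).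
have Q1 : Q 1 by rewrite -(mpolyC1 m R).
elim/big_ind: _ => // e _; rewrite -mul_mpolyC; apply: (QM) => //.
rewrite mpolyXE_id; elim/big_ind: _ => // i _.
by elim: (e i) => [|n IHn]; rewrite ?expr0 ?exprS //; apply: QM.
Qed.

Section Evaluation.

Variables (k E : fieldType) (iota : {rmorphism k -> E}) (m : nat).
Implicit Types (P : 'rV[E]_m) (G H : {mpoly k[m]}).

HB.instance Definition _ P :=
  GRing.RMorphism.copy (evalmp iota P) (mmap iota (fun i => P 0 i)).

Lemma evalmpC P c : evalmp iota P c%:MP = iota c.
Proof. exact: mmapC. Qed.

Lemma evalmpX P i : evalmp iota P 'X_i = P 0 i.
Proof. by rewrite /evalmp mmapX mmap1U. Qed.

Lemma evalmpZ P c G : evalmp iota P (c *: G) = iota c * evalmp iota P G.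
Proof. exact: mmapZ. Qed.

Lemma evalmp_homog d G P c :
  G \is d.-homog -> evalmp iota (c *: P) G = c ^+ d * evalmp iota P G.
Proof.
move=> /dhomogP homG; rewrite /evalmp /mmap mulr_sumr.
rewrite !big_seq; apply: eq_bigr => e /homG /= <-; rewrite mulrCA; congr (_ * _).
rewrite /mmap1 mdegE -prodrXr -big_split /=.
by apply: eq_bigr => i _; rewrite mxE exprMn.
Qed.

End Evaluation.

(* The multiplier [x_i^D] is allowed for all large [D] so that two
   homogenizations can be added after being brought to the same degree. *)
Lemma homogenization (k : fieldType) N (i : 'I_N.+1) (G : {mpoly k[N.+1]}) :
  exists D0, forall D, (D0 <= D)%N -> exists2 Gh : {mpoly k[N.+1]},
    Gh \is D.-homog &
    forall (E : fieldType) (iota : {rmorphism k -> E}) (P : 'rV[E]_N.+1),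
      P 0 i != 0 ->
      evalmp iota P Gh = P 0 i ^+ D * evalmp iota ((P 0 i)^-1 *: P) G.
Proof.
have homXi D : ('X_i : {mpoly k[N.+1]}) ^+ D \is D.-homog.
  by rewrite -{2}[D]mul1n; apply: dhomogMn; rewrite dhomogX /= mdeg1.
elim/mpoly_ring_ind: G => [c|j|G H [D1 IHG] [D2 IHH]|G H [D1 IHG] [D2 IHH]].
- exists 0%N => D _; exists (c *: 'X_i ^+ D); first exact: dhomogZ.
  by move=> E iota P _; rewrite evalmpZ rmorphXn /= evalmpX evalmpC mulrC.
- exists 1%N => -[//|D] _; exists ('X_j * 'X_i ^+ D).
    by rewrite -[D.+1]/(1 + D)%N; apply: dhomogM => //; rewrite dhomogX /= mdeg1.
  move=> E iota P Pi_neq0; rewrite rmorphM rmorphXn /= !evalmpX mxE exprSr.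
  by rewrite -mulrA mulVKf // mulrC.
- exists (maxn D1 D2) => D; rewrite geq_max => /andP[/IHG[G' hG' eG] /IHH[H' hH' eH]].
  exists (G' + H'); first exact: dhomogD.
  by move=> E iota P Pi; rewrite !rmorphD /= eG // eH // mulrDr.
exists (D1 + D2)%N => D leD; have [G' hG' eG] := IHG _ (leqnn _).
have [|H' hH' eH] := IHH (D - D1)%N; first by rewrite leq_subRL // (leq_trans _ leD) ?leq_addr.
have eD : D = (D1 + (D - D1))%N by rewrite subnKC // (leq_trans _ leD) ?leq_addr.
exists (G' * H'); first by rewrite {1}eD; apply: dhomogM.
move=> E iota P Pi; rewrite !rmorphM /= eG // eH //.
by rewrite [in RHS]eD exprD mulrACA.
Qed.

(* Evaluating the derivatives of the expansion at [p] identifies [h j] with the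
   partial derivatives, so only its existence has to be proved. *)
Lemma taylor1 (k : fieldType) m (p : 'rV[k]_m) (G : {mpoly k[m]}) :
  exists2 h : 'I_m -> {mpoly k[m]},
    G = (evalmp idfun p G)%:MP + \sum_j ('X_j - (p 0 j)%:MP) * h j &
    forall j, evalmp idfun p (h j) = evalmp idfun p (mderiv j G).
Proof.
suff [h eG] : exists h : 'I_m -> {mpoly k[m]},
    G = (evalmp idfun p G)%:MP + \sum_j ('X_j - (p 0 j)%:MP) * h j.
  exists h => // j; rewrite {1}eG mderivD mderivC add0r.
  rewrite (raddf_sum (mderiv j)) raddf_sum /= (bigD1 j) //= big1 ?addr0 => [|l ne_lj].
    rewrite mderivM mderivB mderivX mderivC rmorphD /= rmorphM /= mnm1E eqxx scale1r.
    have -> : (U_(j) - U_(j))%MM = 0%MM :> 'X_{1..m}.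
      by apply/mnmP => l; rewrite mnmBE subnn mnm0E.
    rewrite subr0 mpolyX0 rmorph1 mul1r rmorphM /= rmorphB /=.
    by rewrite evalmpX evalmpC subrr mul0r addr0.
  rewrite mderivM mderivB mderivX mderivC rmorphD /= rmorphM /= mnm1E.
  rewrite (negPf ne_lj) scale0r subr0 rmorph0 mul0r add0r rmorphM /= rmorphB /=.
  by rewrite evalmpX evalmpC subrr mul0r.
elim/mpoly_ring_ind: G => [c|i|G H [g eG] [h eH]|G H [g eG] [h eH]].
- by exists (fun=> 0); rewrite evalmpC big1 ?addr0 // => j _; rewrite mulr0.
- exists (fun j => (j == i)%:R); rewrite evalmpX (bigD1 i) //= eqxx mulr1 big1.
    by rewrite addr0 addrC subrK.
  by move=> j /negPf->; rewrite mulr0.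
- exists (fun j => g j + h j); rewrite rmorphD /= mpolyCD {1}eG {1}eH addrACA.
  by rewrite -big_split /=; congr (_ + _); apply: eq_bigr => j _; rewrite mulrDr.
(* From [G H - G(p) H(p) = (G - G(p)) H + G(p) (H - H(p))]. *)
exists (fun j => g j * H + (evalmp idfun p G)%:MP * h j).
rewrite rmorphM /= mpolyCM {1}eG mulrDl {1}eH mulrDr -addrA; congr (_ + _).
rewrite mulr_sumr mulr_suml -big_split; apply: eq_bigr => j _ /=.
by rewrite mulrDr addrC mulrA (mulrCA _ ('X_j - _)).
Qed.

(** * Rational places and local rings *)

Lemma ltn_rank_col_mx (k : fieldType) s m (A : 'M[k]_(s, m)) (c : 'rV_m) :
  ~~ (c <= A)%MS -> (\rank A < \rank (col_mx A c))%N.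
Proof.
move=> cA; apply: rank_ltmx; rewrite ltmxE -{1}addsmxE addsmxSl /=.
by rewrite col_mx_sub (negPf cA) andbF.
Qed.

Lemma coef0_neq0_factor (k : fieldType) (g : {poly k}) : g != 0 ->
  exists e (g' : {poly k}), g = 'X^e * g' /\ g'`_0 != 0.
Proof.
elim/poly_ind: g => [|g c IHg]; first by rewrite eqxx.
have [->|c0] := eqVneq c 0; last first.
  exists 0%N, (g * 'X + c%:P); rewrite expr0 mul1r; split=> //.
  by rewrite coefD coefMX coefC /= add0r.
rewrite addr0 mulf_eq0 negb_or => /andP[/IHg [e [g' [-> g0]]] _].
by exists e.+1, g'; rewrite exprSr mulrAC -mulrA.
Qed.

Section Places.

Variables (k K : fieldType) (iota : {rmorphism k -> K}).

(* [R z c] means that [z] is regular at the place and has value [c] there. *)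
Record rational_place (R : K -> k -> Prop) : Prop := RationalPlace {
  placeC : forall c, R (iota c) c;
  placeD : forall z z' c c', R z c -> R z' c' -> R (z + z') (c + c');
  placeM : forall z z' c c', R z c -> R z' c' -> R (z * z') (c * c');
  place_fun : forall z c c', R z c -> R z c' -> c = c';
  place_total : forall z, (exists c, R z c) \/ R z^-1 0
}.

Section PlaceTheory.

Variables (R : K -> k -> Prop) (plR : rational_place R).

Lemma place0 : R 0 0.
Proof. by rewrite -[X in R X](rmorph0 iota); apply: placeC. Qed.

Lemma place1 : R 1 1.
Proof. by rewrite -[X in R X](rmorph1 iota); apply: placeC. Qed.

Lemma placeX z c n : R z c -> R (z ^+ n) (c ^+ n).
Proof.
move=> Rz; elim: n => [|n IHn]; first exact: place1.
by rewrite !exprS; apply: placeM.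
Qed.

Lemma placeN z c : R z c -> R (- z) (- c).
Proof.
move=> Rz; rewrite -mulN1r -[- c]mulN1r; apply: placeM => //.
by rewrite -(rmorph1 iota) -rmorphN; apply: placeC.
Qed.

Lemma placeB z z' c c' : R z c -> R z' c' -> R (z - z') (c - c').
Proof. by move=> Rz Rz'; apply: placeD => //; apply: placeN. Qed.

Lemma place_neq0 z c : R z c -> c != 0 -> z != 0.
Proof. by move=> Rz; apply: contraNneq => z0; rewrite z0 in Rz; apply/eqP/(place_fun plR Rz place0). Qed.

Lemma placeV z c : R z c -> c != 0 -> R z^-1 c^-1.
Proof.
move=> Rz c0; have z0 := place_neq0 Rz c0.
have [[c' Rz']|] := place_total plR z^-1.
  suff -> : c^-1 = c' by [].
  apply: (mulfI c0); rewrite divff //; apply: (place_fun plR place1).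
  by rewrite -(divff z0); apply: placeM.
by rewrite invrK => /(place_fun plR Rz) c_eq0; rewrite c_eq0 eqxx in c0.
Qed.

Lemma place_regular_or_pole z : (exists c, R z c) \/ z != 0 /\ R z^-1 0.
Proof.
have [->|z0] := eqVneq z 0; first by left; exists 0; apply: place0.
by have [|] := place_total plR z; [left | right].
Qed.

Lemma place_evalmp m (r : 'rV[K]_m) (p : 'rV[k]_m) G :
  (forall j, R (r 0 j) (p 0 j)) -> R (evalmp iota r G) (evalmp idfun p G).
Proof.
move=> Rr; elim/mpoly_ring_ind: G => [c|i|G H RG RH|G H RG RH].
- by rewrite !evalmpC; apply: placeC.
- by rewrite !evalmpX.
- by rewrite !rmorphD; apply: placeD.
by rewrite !rmorphM; apply: placeM.
Qed.

End PlaceTheory.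

(** Valuation rings are maximal for domination: if a nonzero [z], regular for [R'], were not regular
    for [R], its inverse would have value 0 for both, and so would [1 = z * z^-1] for [R']. *)
Lemma place_maximal R R' : rational_place R -> rational_place R' ->
  (forall z c, R z c -> R' z c) -> forall z c, R' z c -> R z c.
Proof.
move=> plR plR' sRR' z c R'z; have [[c' Rz]|/sRR' R'zV] := place_total plR z.
  by rewrite (place_fun plR' R'z (sRR' _ _ Rz)).
have [z0|z0] := eqVneq z 0.
  by rewrite z0 in R'z *; rewrite (place_fun plR' R'z (place0 plR')); apply: place0.
have := placeM plR' R'z R'zV; rewrite divff // mulr0.
by move=> /(place_fun plR' (place1 plR'))/eqP; rewrite oner_eq0.
Qed.

(* The residue map of the local ring of [p] on the affine variety with generic
   point [r]. *)
Definition local_value m (r : 'rV[K]_m) (p : 'rV[k]_m) (z : K) (c : k) :=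
  exists G H : {mpoly k[m]}, [/\ evalmp idfun p H != 0,
    z = evalmp iota r G / evalmp iota r H &
    c = evalmp idfun p G / evalmp idfun p H].

(* [p] is a specialization of the generic point [r] of a model of [K], and the
   maximal ideal at [p] has at least [m - 1] independent relations modulo its
   square: the matrix [h] plays the role of the Jacobian. *)
Record regular_specialization m (r : 'rV[K]_m) (p : 'rV[k]_m) : Prop :=
  RegularSpecialization {
    specialization : forall G, evalmp iota r G = 0 -> evalmp idfun p G = 0;
    generic_point : forall z, exists G H : {mpoly k[m]},
      evalmp iota r H != 0 /\ z = evalmp iota r G / evalmp iota r H;
    regularity : exists s (h : 'M[{mpoly k[m]}]_(s, m)),
      (forall i, \sum_j evalmp iota r (h i j) * (r 0 j - iota (p 0 j)) = 0) /\
      (m <= \rank (map_mx (evalmp idfun p) h) + 1)%N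
  }.

(** The outer variable of [F] stands for [z], the inner one, in the coefficients, for [t]. *)
Definition eval2 (t z : K) (F : {poly {poly k}}) : K :=
  (map_poly (horner_eval t \o map_poly iota) F).[z].

(** As [z] is nonzero, powers of the outer variable cancel from the relation. *)
Lemma coef0_neq0_eval2 (t z : K) (F : {poly {poly k}}) : z != 0 -> F != 0 ->
  eval2 t z F = 0 -> exists2 F' : {poly {poly k}}, F'`_0 != 0 & eval2 t z F' = 0.
Proof.
move=> z0; elim/poly_ind: F => [|F c IHF]; first by rewrite eqxx.
have [->|c0] := eqVneq c 0; last first.
  move=> _ eF; exists (F * 'X + c%:P) => //.
  by rewrite coefD coefMX coefC /= add0r.
rewrite addr0 mulf_eq0 negb_or /eval2 rmorphM hornerM => /andP[F0 _].
rewrite /= map_polyX hornerX => /eqP.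
by rewrite mulf_eq0 (negPf z0) orbF => /eqP; apply: IHF.
Qed.

(** Transcendence degree at most 1 over [k]. *)
Definition algebraically_dependent := forall t z : K,
  exists2 F : {poly {poly k}}, F != 0 & eval2 t z F = 0.

(** * The local ring at a regular specialization is a valuation ring *)

Section LocalRing.

Variables (m : nat) (r : 'rV[K]_m) (p : 'rV[k]_m).
Hypothesis reg : regular_specialization r p.

Local Notation ev := (evalmp iota r).
Local Notation evp := (evalmp (idfun : {rmorphism k -> k}) p).
Local Notation O := (local_value r p).

Lemma special_neq0 H : evp H != 0 -> ev H != 0.
Proof. by apply: contraNneq => /(specialization reg)->. Qed.

Lemma local_valueP G : O (ev G) (evp G).
Proof. by exists G, 1; rewrite !rmorph1 !divr1 oner_eq0. Qed.

Lemma local_valueC c : O (iota c) c.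
Proof. by have := local_valueP c%:MP; rewrite !evalmpC. Qed.

Lemma local_valueD z z' c c' : O z c -> O z' c' -> O (z + z') (c + c').
Proof.
move=> [G [H [H0 -> ->]]] [G' [H' [H0' -> ->]]].
exists (G * H' + G' * H), (H * H'); rewrite !rmorphD !rmorphM /= mulf_neq0 //.
by split=> //; rewrite addf_div // special_neq0.
Qed.

Lemma local_valueM z z' c c' : O z c -> O z' c' -> O (z * z') (c * c').
Proof.
move=> [G [H [H0 -> ->]]] [G' [H' [H0' -> ->]]].
by exists (G * G'), (H * H'); rewrite !rmorphM /= mulf_neq0 // !mulf_div.
Qed.

Lemma local_valueX z c n : O z c -> O (z ^+ n) (c ^+ n).
Proof.
move=> Oz; elim: n => [|n IHn]; last by rewrite !exprS; apply: local_valueM.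
by have := local_valueC 1; rewrite rmorph1.
Qed.

Lemma local_valueV z c : O z c -> c != 0 -> O z^-1 c^-1.
Proof.
move=> [G [H [H0 -> ->]]]; rewrite mulf_eq0 negb_or => /andP[G0 _].
by exists H, G; rewrite !invf_div.
Qed.

Lemma local_value_fun z c c' : O z c -> O z c' -> c = c'.
Proof.
move=> [G [H [H0 -> ->]]] [G' [H' [H0' /eqP]]].
rewrite eqr_div ?special_neq0 // -!rmorphM /= -subr_eq0 -rmorphB /=.
move=> /eqP/(specialization reg)/eqP.
by rewrite rmorphB !rmorphM subr_eq0 -eqr_div //= => /eqP -> ->.
Qed.

(** The relations [h] between the [r_j - p_j] have corank at most 1 at [p], so together with one
    linear form [tau] they determine all these differences. Cramer's rule solves for them with a
    denominator [d] that is a unit at [p]. *)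
Lemma uniformizer : exists (tau d : {mpoly k[m]}) (a : 'I_m -> {mpoly k[m]}),
  [/\ evp tau = 0, evp d != 0 &
      forall j, ev d * (r 0 j - iota (p 0 j)) = ev (a j) * ev tau].
Proof.
have [s [h [h_rel rk_h]]] := regularity reg; set J := map_mx evp h in rk_h.
have [c full_Jc] : exists c : 'rV[k]_m, (1%:M <= col_mx J c)%MS.
  have [J_full|] := boolP (1%:M <= J)%MS.
    by exists 0; rewrite (submx_trans J_full) // -addsmxE addsmxSl.
  case/row_subPn => i /ltn_rank_col_mx lt_rk; exists (row i 1%:M).
  rewrite sub1mx /row_full eqn_leq rank_leq_col /=.
  by rewrite (leq_trans rk_h) // addn1.
have [M defM] := submxP full_Jc.
pose C := @mpolyC m k; pose MC := map_mx C M.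
(* [M] is a left inverse of [J] completed by the row [c]. Its constant lift makes [U] the identity
   at [p], so [\det U] has value 1 there. *)
pose U := MC *m col_mx h (map_mx C c).
pose rho := \col_j (r 0 j - iota (p 0 j)) : 'cV[K]_m.
pose tau := \sum_j C (c 0 j) * ('X_j - C (p 0 j)).
have evC : ev \o C =1 iota by move=> x; rewrite /= evalmpC.
have evpC : evp \o C =1 id by move=> x; rewrite /= evalmpC.
have U1 : map_mx evp U = 1%:M.
  rewrite defM map_mxM map_col_mx -!map_mx_comp (eq_map_mx _ evpC) map_mx_id //.
  by rewrite (eq_map_mx _ evpC) map_mx_id.
(* The rows of [h] annihilate [rho]; only the last row, that of [tau], contributes. *)
have eU : map_mx ev U *m rho = map_mx ev (MC *m col_mx 0 1%:M) *m (ev tau)%:M.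
  rewrite !map_mxM !map_col_mx -!mulmxA !mul_col_mx; congr (_ *m col_mx _ _).
    apply/matrixP => i j; rewrite ord1 map_mx0 mul0mx !mxE -[RHS](h_rel i).
    by apply: eq_bigr => l _; rewrite !mxE.
  apply/matrixP => i j; rewrite !ord1 map_mx1 mul1mx !mxE eqxx mulr1n rmorph_sum.
  apply: eq_bigr => l _; rewrite !mxE rmorphM rmorphB /= evalmpX.
  by rewrite !evalmpC.
exists tau, (\det U), (fun j => (\adj U *m (MC *m col_mx 0 1%:M)) j 0).
split=> [||j].
- rewrite rmorph_sum big1 // => j _; rewrite rmorphM rmorphB /= evalmpX !evalmpC.
  by rewrite /= subrr mulr0.
- by rewrite -det_map_mx U1 det1 oner_eq0.
have := congr1 (fun A => (map_mx ev (\adj U) *m A) j 0) eU.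
rewrite !mulmxA -!map_mxM mul_adj_mx map_scalar_mx mul_scalar_mx -mulmxA.
rewrite mul_mx_scalar [X in X = _ -> _]mxE [X in _ * X = _ -> _]mxE.
by rewrite [X in _ = X -> _]mxE => ->; rewrite mulrC mxE.
Qed.

Lemma ev_taylor1 G : exists h : 'I_m -> {mpoly k[m]},
  ev G = iota (evp G) + \sum_j (r 0 j - iota (p 0 j)) * ev (h j).
Proof.
have [h eG _] := taylor1 p G; exists h.
rewrite {1}eG rmorphD /= evalmpC; congr (_ + _); rewrite rmorph_sum.
by apply: eq_bigr => j _; rewrite rmorphM rmorphB /= evalmpX evalmpC.
Qed.

Lemma local_value_horner t (g : {poly k}) : O t 0 ->
  O (map_poly iota g).[t] g`_0.
Proof.
move=> Ot; elim/poly_ind: g => [|g c IHg].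
  by rewrite rmorph0 horner0 coef0 -(rmorph0 iota); apply: local_valueC.
rewrite rmorphD rmorphM /= map_polyX map_polyC !hornerE coefD coefMX coefC /=.
apply: local_valueD; last exact: local_valueC.
by rewrite -(mulr0 g`_0); apply: local_valueM.
Qed.

Hypothesis alg_dep : algebraically_dependent.

(* A relation [F(t, z) = 0] with [F(T, 0) = T^e g(T)], [g(0) <> 0], puts
   [t^e g(t)] in the ideal of [z], so that [z] cannot be divisible by [t^e.+1]. *)
Lemma bounded_order t z : O t 0 -> t != 0 -> z != 0 ->
  exists e, forall v c, O v c -> z <> t ^+ e.+1 * v.
Proof.
move=> Ot t0 z0; have [F F0 eF] := alg_dep t z.
have [{}F {F0 eF} F0 eF] := coef0_neq0_eval2 z0 F0 eF.
have [e [g [eg g0]]] := coef0_neq0_factor F0; exists e => v c Ov ez.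
have [w [d [Ow ew]]] : exists w d, O w d /\ eval2 t z F = (map_poly iota F`_0).[t] + z * w.
  have Oz : exists cz, O z cz.
    by exists (0 ^+ e.+1 * c); rewrite ez; apply: local_valueM => //; apply: local_valueX.
  elim/poly_ind: (F) => [|f a [w [d [Ow IHf]]]].
    exists 0, 0; rewrite /eval2 coef0 !rmorph0 !horner0 mulr0 addr0; split=> //.
    by rewrite -(rmorph0 iota); apply: local_valueC.
  have [cz Ocz] := Oz; exists (eval2 t z f), (f`_0`_0 + cz * d); split.
    rewrite IHf; apply: local_valueD; last exact: local_valueM.
    exact: local_value_horner.
  rewrite coefD coefMX coefC /= add0r /eval2 rmorphD rmorphM /= map_polyX.
  by rewrite map_polyC !hornerE addrC mulrC.
move: ew; rewrite eF eg rmorphM /= map_polyXn hornerM hornerXn ez exprSr.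
rewrite -!mulrA -mulrDr => /esym/eqP; rewrite mulf_eq0 expf_eq0 (negPf t0) andbF /=.
rewrite addr_eq0 => /eqP eg'; case/eqP: g0.
apply: (local_value_fun (local_value_horner g Ot)); rewrite eg' -mulN1r.
have -> : 0 = -1 * (0 * (c * d)) by rewrite mul0r mulr0.
apply: local_valueM; last by do 2!apply: local_valueM => //.
by rewrite -(rmorph1 iota) -rmorphN; apply: local_valueC.
Qed.

(** Every nonzero [ev G] is a power of the uniformizer [t] times a unit, so a nonzero [z] is a unit
    times an integral power of [t], and the sign of the exponent decides. *)
Lemma local_value_total z : (exists c, O z c) \/ O z^-1 0.
Proof.
have [tau [d [a [tau0 d0 ea]]]] := uniformizer; set t := ev tau in ea.
have Ot : O t 0 by rewrite -tau0; apply: local_valueP.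
have evd0 := special_neq0 d0.
(* If [t] vanishes, so does the maximal ideal, and every element of [K] comes from [k]. *)
have [t0|t0] := eqVneq t 0.
  have evE G : ev G = iota (evp G).
    have [h ->] := ev_taylor1 G; rewrite big1 ?addr0 // => j _.
    have /eqP := ea j; rewrite t0 mulr0 mulf_eq0 (negPf evd0) /= => /eqP->.
    by rewrite mul0r.
  have [G [H [H0 ->]]] := generic_point reg z; left.
  exists (evp G / evp H), G, H; split=> //.
  by apply: contraNneq H0; rewrite evE => ->; rewrite rmorph0.
(* Taylor expansion at [p] expresses an element of value 0 through the [r_j - p_j], which are
   multiples of [t] up to the unit [d]. *)
have div_t v : O v 0 -> exists v' c', O v' c' /\ v = t * v'.
  move=> [G [H [H0 -> /esym/eqP]]]; rewrite mulf_eq0 invr_eq0 (negPf H0) orbF => /eqP G0.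
  have [h ->] := ev_taylor1 G; rewrite G0 rmorph0 add0r.
  exists (ev (\sum_j a j * h j) / ev (d * H)), (evp (\sum_j a j * h j) / evp (d * H)).
  split; first by exists (\sum_j a j * h j), (d * H); rewrite rmorphM mulf_neq0.
  rewrite mulrA !rmorphM /= invfM [RHS]mulrA; congr (_ / _).
  apply: (mulIf evd0); rewrite mulfVK // mulr_suml rmorph_sum mulr_sumr.
  by apply: eq_bigr => j _; rewrite rmorphM /= mulrAC [_ * ev d]mulrC ea mulrA [t * _]mulrC.
have ordP G : ev G != 0 -> exists e v c, [/\ O v c, c != 0 & ev G = t ^+ e * v].
  move=> G0; have [e0 ub] := bounded_order Ot t0 G0.
  (* Factors [t] are taken out one at a time until a unit is left; [bounded_order] ends the
     process. *)
  have step n : (exists e v c, [/\ O v c, c != 0 & ev G = t ^+ e * v]) \/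
      (exists v c, O v c /\ ev G = t ^+ n * v).
    elim: n => [|n [|[v [c [Ov eG]]]]]; last 1 first.
    - have [c0|c0] := eqVneq c 0; last by left; exists n, v, c.
      rewrite c0 in Ov; have [v' [c' [Ov' ev']]] := div_t v Ov.
      by right; exists v', c'; rewrite exprSr -mulrA -ev'.
    - by right; exists (ev G), (evp G); rewrite expr0 mul1r; split=> //; apply: local_valueP.
    by left.
  by have [//|[v [c [Ov /ub]]]] := step e0.+1; move/(_ c)/(_ Ov).
have [->|z0] := eqVneq z 0.
  by left; exists 0; rewrite -(rmorph0 iota); apply: local_valueC.
have [G [H [H0 ez]]] := generic_point reg z.
have G0 : ev G != 0 by apply: contraNneq z0; rewrite ez => ->; rewrite mul0r.
have [e [v [c [Ov c0 eG]]]] := ordP G G0.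
have [f [w [d' [Ow d'0 eH]]]] := ordP H H0.
have [le_fe|lt_ef] := leqP f e; [left | right].
  exists (0 ^+ (e - f) * (c / d')).
  have -> : z = t ^+ (e - f) * (v / w).
    by rewrite ez eG eH -mulf_div -expfB_cond ?(negPf t0).
  by apply: local_valueM; [apply: local_valueX | apply: local_valueM => //; apply: local_valueV].
have -> : z^-1 = t ^+ (f - e) * (w / v).
  by rewrite ez invf_div eG eH -mulf_div -expfB_cond ?(negPf t0) // ltnW.
rewrite -(mul0r (d' / c)); apply: local_valueM.
  by have := local_valueX (f - e) Ot; rewrite expr0n subn_eq0 leqNgt lt_ef.
by apply: local_valueM => //; apply: local_valueV.
Qed.

Lemma local_place : rational_place O.
Proof.
split; [exact: local_valueC | exact: local_valueD | exact: local_valueM |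
        exact: local_value_fun | exact: local_value_total].
Qed.

End LocalRing.

(** The local ring is itself a place, dominated by [R], so [place_maximal] makes the two equal. *)
Lemma place_local_value m (r : 'rV[K]_m) (p : 'rV[k]_m) R :
  algebraically_dependent -> regular_specialization r p -> rational_place R ->
  (forall j, R (r 0 j) (p 0 j)) -> forall z c, R z c <-> local_value r p z c.
Proof.
move=> dep reg plR Rr.
have sub z c : local_value r p z c -> R z c.
  move=> [G [H [H0 -> ->]]]; apply: placeM => //; first exact: place_evalmp.
  by apply: placeV => //; apply: place_evalmp.
by split=> [|/sub //]; apply: place_maximal sub _ _ => //; apply: local_place.
Qed.

End Places.

(** * Algebraic dependence *)

Lemma linear_dependence (k K : fieldType) (iota : {rmorphism k -> K})
    (I J : finType) (v : I -> K) (e : J -> K) :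
  (#|J| < #|I|)%N ->
  (forall i, exists c : J -> k, v i = \sum_j iota (c j) * e j) ->
  exists2 l : I -> k, (exists i, l i != 0) & \sum_i iota (l i) * v i = 0.
Proof.
move=> ltJI /fin_all_exists[c vE].
pose A := \matrix_(i < #|I|, j < #|J|) c (enum_val i) (enum_val j).
have kerA : kermx A != 0.
  by rewrite -mxrank_eq0 mxrank_ker -lt0n subn_gt0 (leq_ltn_trans (rank_leq_col A)).
case/rowV0Pn: kerA => u /sub_kermxP uA0 u0.
exists (fun i => u 0 (enum_rank i)).
  by case/rV0Pn: u0 => i ui0; exists (enum_val i); rewrite enum_valK.
under eq_bigr do rewrite vE mulr_sumr.
rewrite exchange_big big1 //= => j _.
under eq_bigr do rewrite mulrA -rmorphM.
rewrite -mulr_suml -rmorph_sum /= (reindex _ (onW_bij _ (@enum_val_bij I))) /=.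
move/matrixP/(_ 0 (enum_rank j)): uA0; rewrite !mxE => uAj.
rewrite (_ : \sum_i _ = 0) ?rmorph0 ?mul0r // -[RHS]uAj.
by apply: eq_bigr => i _; rewrite enum_valK mxE enum_rankK.
Qed.

Lemma horner_map_poly (R : nzRingType) (K : fieldType)
    (g : {rmorphism R -> K}) n (f : nat -> R) u :
  (map_poly g (\poly_(i < n) f i)).[u] = \sum_(i < n) g (f i) * u ^+ i.
Proof.
rewrite (@horner_coef_wide _ n).
  by apply: eq_bigr => i _; rewrite coef_map coef_poly ltn_ord.
by apply: leq_trans (size_poly _ _); apply: size_poly.
Qed.

(** * Growth of the spaces spanned by monomials in [x] and [y] *)

Section IntegralGenerator.

Variables (k K : fieldType) (iota : {rmorphism k -> K}) (w : 'rV[K]_2) (q : nat).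

Local Notation x := (w 0 0).
Local Notation y := (w 0 1).

(** A filtration by the degree in [x]: level [D] is spanned by [D * q] monomials, so its dimension
    grows at most linearly in [D]. The inductive form allows induction on the number of terms. *)
Inductive xyspan (D : nat) : K -> Prop :=
| XYspan0 : xyspan D 0
| XYspanD (c : k) i j z : (i < D)%N -> (j < q)%N -> xyspan D z ->
    xyspan D (iota c * x ^+ i * y ^+ j + z).

Lemma xyspan_monomial D c i j : (i < D)%N -> (j < q)%N ->
  xyspan D (iota c * x ^+ i * y ^+ j).
Proof.
by move=> iD jq; rewrite -[_ * _]addr0; apply: XYspanD => //; apply: XYspan0.
Qed.

Lemma xyspan_leq D D' z : (D <= D')%N -> xyspan D z -> xyspan D' z.
Proof.
move=> leD; elim=> [|c i j {}z iD jq _ IHz]; first exact: XYspan0.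
by apply: XYspanD => //; apply: leq_trans leD.
Qed.

Lemma xyspan_add D z z' : xyspan D z -> xyspan D z' -> xyspan D (z + z').
Proof.
move=> Dz Dz'; elim: Dz => [|c i j {}z iD jq _ IHz]; first by rewrite add0r.
by rewrite -addrA; apply: XYspanD.
Qed.

Lemma xyspan_mulX D z c n :
  xyspan D z -> xyspan (D + n) (iota c * x ^+ n * z).
Proof.
elim=> [|a i j {}z iD jq _ IHz]; first by rewrite mulr0; apply: XYspan0.
rewrite mulrDr [_ * (_ * y ^+ j)]mulrA mulrACA -rmorphM -exprD.
by apply: XYspanD => //; rewrite addnC ltn_add2r.
Qed.

Lemma xyspan_coord D z : xyspan D z -> exists c : 'I_D * 'I_q -> k,
  z = \sum_ij iota (c ij) * (x ^+ ij.1 * y ^+ ij.2).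
Proof.
elim=> [|a i j {}z iD jq _ [c ->]].
  by exists (fun=> 0); rewrite big1 // => ij _; rewrite rmorph0 mul0r.
pose ij0 := (Ordinal iD, Ordinal jq).
exists (fun ij => (if ij == ij0 then a else 0) + c ij).
under [RHS]eq_bigr do rewrite rmorphD mulrDl.
rewrite big_split /=; congr (_ + _); rewrite (bigD1 ij0) //= eqxx big1 ?addr0 ?mulrA //.
by move=> ij /negPf->; rewrite rmorph0 mul0r.
Qed.

Variable e : nat.
Hypothesis y_integral : xyspan e (y ^+ q).

(** When the exponent of [y] reaches [q], [y_integral] brings it back below [q] at the cost of a
    shift by [e] in the degree in [x]. *)
Lemma xyspan_mulY D z : xyspan D z -> xyspan (D + e) (y * z).
Proof.
elim=> [|a i j {}z iD jq _ IHz]; first by rewrite mulr0; apply: XYspan0.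
rewrite mulrDr mulrCA -exprS; have [jq'|] := ltnP j.+1 q.
  by apply: XYspanD => //; rewrite ltn_addr.
move=> le_qj; have -> : j.+1 = q by apply/eqP; rewrite eqn_leq jq.
apply: xyspan_add => //; apply: xyspan_leq (xyspan_mulX _ _ y_integral).
by rewrite addnC leq_add2r ltnW.
Qed.

Definition span_multiplier d g :=
  forall D z, xyspan D z -> xyspan (D + d) (g * z).

Lemma span_multiplier_leq d d' g :
  (d <= d')%N -> span_multiplier d g -> span_multiplier d' g.
Proof. by move=> led mg D z /mg; apply: xyspan_leq; rewrite leq_add2l. Qed.

Lemma span_multiplierM d d' g g' : span_multiplier d g ->
  span_multiplier d' g' -> span_multiplier (d + d') (g * g').
Proof. by move=> mg mg' D z Dz; rewrite -mulrA [(d + _)%N]addnC addnA; apply/mg/mg'. Qed.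

Lemma span_multiplierX d g n :
  span_multiplier d g -> span_multiplier (n * d) (g ^+ n).
Proof.
move=> mg; elim: n => [|n IHn].
  by move=> D z Dz; rewrite expr0 mul1r addn0.
by rewrite exprS mulSn; apply: span_multiplierM.
Qed.

Lemma span_multiplier_evalmp G : exists d, span_multiplier d (evalmp iota w G).
Proof.
elim/mpoly_ring_ind: G => [c|i|G H [d mG] [d' mH]|G H [d mG] [d' mH]].
- exists 0%N => D z Dz; rewrite evalmpC -[iota c]mulr1 -(expr0 x).
  exact: xyspan_mulX.
- rewrite evalmpX; have [->|->] : i = 0 \/ i = 1.
    by case: i => -[|[|//]] ?; [left|right]; apply: val_inj.
    exists 1%N => D z Dz; rewrite -[x]mul1r -(rmorph1 iota) -[x]expr1.
    exact: xyspan_mulX.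
  by exists e => D z Dz; apply: xyspan_mulY.
- exists (maxn d d') => D z Dz; rewrite rmorphD mulrDl.
  by apply: xyspan_add; [move/mG: Dz | move/mH: Dz];
    apply: xyspan_leq; rewrite leq_add2l ?leq_maxl ?leq_maxr.
by exists (d + d')%N; rewrite rmorphM; apply: span_multiplierM.
Qed.

Hypotheses (q_gt0 : (0 < q)%N)
  (w_generic : forall z, exists G H, evalmp iota w H != 0 /\
     z = evalmp iota w G / evalmp iota w H).

(* Dimension count: clearing denominators sends the [M^2] monomials [t^i z^j]
   with [i, j < M] into a space of dimension linear in [M]. *)
Lemma integral_algebraically_dependent : algebraically_dependent iota.
Proof.
move=> t z; have [A [B [B0 ->]]] := w_generic t.
have [A' [B' [B0' ->]]] := w_generic z.
have [d1 m1] := span_multiplier_evalmp A; have [d2 m2] := span_multiplier_evalmp B.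
have [d3 m3] := span_multiplier_evalmp A'; have [d4 m4] := span_multiplier_evalmp B'.
set a := evalmp _ _ A in m1 *; set b := evalmp _ _ B in m2 B0 *.
set a' := evalmp _ _ A' in m3 *; set b' := evalmp _ _ B' in m4 B0' *.
clearbody a b a' b'.
(* [d] bounds all four shifts, and [M] is chosen so that [M ^ 2] exceeds [(1 + 2 * (M * d)) * q],
   the number of monomials available. *)
pose d := (d1 + d2 + d3 + d4)%N; pose M := (q * (2 * d + 1)).+1.
have [{}m1 {}m2 {}m3 {}m4] : [/\ span_multiplier d a, span_multiplier d b,
    span_multiplier d a' & span_multiplier d b'].
  by split; [move: m1|move: m2|move: m3|move: m4]; apply: span_multiplier_leq; lia.
(* This is [t ^+ i * z ^+ j] times the common denominator [b ^+ M * b' ^+ M]. *)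
pose v (ij : 'I_M * 'I_M) := a ^+ ij.1 * b ^+ (M - ij.1) * (a' ^+ ij.2 * b' ^+ (M - ij.2)).
have vP ij : xyspan (1 + 2 * (M * d)) (v ij).
  have X1 : xyspan 1 1.
    by have := @xyspan_monomial 1 1 0 0 isT q_gt0; rewrite rmorph1 !mulr1.
  have mp (g h : K) (i : 'I_M) : span_multiplier d g -> span_multiplier d h ->
      span_multiplier (M * d) (g ^+ i * h ^+ (M - i)).
    move=> mg mh; rewrite -{1}(subnKC (ltnW (ltn_ord i))) mulnDl.
    by apply: span_multiplierM; apply: span_multiplierX.
  have := span_multiplierM (mp _ _ ij.1 m1 m2) (mp _ _ ij.2 m3 m4) X1.
  by rewrite mulr1 addnn -mul2n.
have [|l [ij0 lij0] l_rel] := linear_dependence _ (fun ij => xyspan_coord (vP ij)).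
  by rewrite !card_prod !card_ord /M; nia.
exists (\poly_(j < M) \poly_(i < M) l (inord i, inord j)).
  apply: contraNneq lij0 => /polyP/(_ ij0.2)/polyP/(_ ij0.1)/eqP.
  by rewrite !coef_poly !ltn_ord !coef_poly !ltn_ord !inord_val coef0 coef0 -surjective_pairing.
apply: (mulIf (_ : b ^+ M * b' ^+ M != 0)); first by rewrite mulf_neq0 // expf_neq0.
rewrite mul0r -[RHS]l_rel /eval2 horner_map_poly mulr_suml.
under eq_bigr => j _ do rewrite /= horner_evalE horner_map_poly mulr_suml mulr_suml.
rewrite exchange_big pair_bigA; apply: eq_bigr => -[i j] _ /=.
rewrite !inord_val /v /= -!mulrA; congr (_ * _).
have powE (g h : K) (n : 'I_M) : h != 0 -> (g / h) ^+ n * h ^+ M = g ^+ n * h ^+ (M - n).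
  move=> h0; rewrite -{2}(subnKC (ltnW (ltn_ord n))) exprD mulrA.
  by rewrite -exprMn divfK.
rewrite [_ * (b ^+ M * _)]mulrCA [LHS]mulrA powE // powE //.
by rewrite mulrA.
Qed.

End IntegralGenerator.

(** * Places of a nonsingular projective model *)

(** Euler's identity; it makes the Jacobian rows at a point of the locus orthogonal to the
    coordinate vector of that point. *)
Lemma euler_homog (R : comNzRingType) m d (G : {mpoly R[m]}) :
  G \is d.-homog -> \sum_j 'X_j * mderiv j G = d%:R *: G.
Proof.
move=> /dhomogP homG.
have -> : \sum_j 'X_j * mderiv j G =
    \sum_(e <- msupp G) G@_e *: \sum_j 'X_j * mderiv j 'X_[e].
  under [RHS]eq_bigr do rewrite scaler_sumr.
  rewrite exchange_big; apply: eq_bigr => j _ /=.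
  rewrite {1}[G]mpolyE (raddf_sum (mderiv j)) mulr_sumr; apply: eq_bigr => e _.
  by rewrite /= mderivZ -scalerAr.
rewrite {3}[G]mpolyE scaler_sumr !big_seq; apply: eq_bigr => e /homG /= eD.
rewrite scalerA mulrC -scalerA; congr (_ *: _); rewrite -eD mdegE natr_sum scaler_suml.
apply: eq_bigr => j _; rewrite mderivX -scalerAr.
have [->|ej0] := eqVneq (e j) 0%N; first by rewrite !scale0r.
by rewrite -mpolyXD addmC submK // lep1mP.
Qed.

Section ProjectiveModel.

Variables (k K : fieldType) (iota : {rmorphism k -> K}).
Variables (N : nat) (X : seq {mpoly k[N.+1]}) (u : 'rV[K]_N.+1).
Hypotheses (formsX : forms X) (nsX : nonsingular_curve X).
Hypothesis ffX : proj_function_field X iota u.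

Lemma on_locusZ (P : 'rV[k]_N.+1) c : c != 0 ->
  on_locus idfun X P -> on_locus idfun X (c *: P).
Proof.
move=> c0 /andP[P0 /allP XP]; rewrite /on_locus scaler_eq0 negb_or c0 P0 /=.
apply/allP => G GX; have [d homG] := formsX GX.
by rewrite (evalmp_homog _ _ _ homG) (eqP (XP G GX)) mulr0.
Qed.

Lemma proj_generic_neq0 (P : 'rV[k]_N.+1) i :
  on_locus idfun X P -> P 0 i != 0 -> u 0 i != 0.
Proof.
have [_ special _] := ffX => XP; apply: contraNneq => ui0.
have := special 1%N 'X_i; rewrite dhomogX /= mdeg1 evalmpX => /(_ isT ui0).
by move=> /(_ k idfun P XP); rewrite evalmpX => ->.
Qed.

(** In the chart [X_i = 1], this equation joins those of [X]. Its gradient [e_i] pairs to 1 with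
    [p], whereas the rows of the Jacobian are orthogonal to [p] by Euler's identity, so the rank
    rises from [N - 1] to at least [N]. *)
Lemma proj_regular_specialization (P : 'rV[k]_N.+1) i :
  on_locus idfun X P -> P 0 i != 0 ->
  regular_specialization iota ((u 0 i)^-1 *: u) ((P 0 i)^-1 *: P).
Proof.
move=> XP Pi0; have ui0 := proj_generic_neq0 XP Pi0.
have [/andP[_ /allP Xu] special fracs] := ffX.
set r := _ *: u; set p := _ *: P.
have Xp : on_locus idfun X p by apply: on_locusZ => //; rewrite invr_eq0.
have ri : r 0 i = 1 by rewrite mxE mulVf.
have pi : p 0 i = 1 by rewrite mxE mulVf.
split=> [G Gr0|z|].
- have [D0 /(_ _ (leqnn _)) [Gh homGh GhE]] := homogenization i G.
  have := special _ _ homGh; rewrite GhE // -/r Gr0 mulr0 => /(_ erefl k idfun P XP).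
  by rewrite GhE // => /eqP; rewrite mulf_eq0 expf_eq0 (negPf Pi0) andbF => /eqP.
- have [d [G [H [homG homH H0 ->]]]] := fracs z; exists G, H.
  rewrite (evalmp_homog _ _ _ homG) (evalmp_homog _ _ _ homH).
  have c0 : (u 0 i)^-1 ^+ d != 0 by rewrite expf_neq0 // invr_eq0.
  by split; [rewrite mulf_neq0 | rewrite -mulf_div divff // mul1r].
have [h hE h_deriv] := fin_all_exists2 (fun l : 'I_(size X) => taylor1 p X`_l).
exists (size X + 1)%N, (col_mx (\matrix_(l, j) h l j) (\row_j (j == i)%:R)); split.
  move=> l; case: (split_ordP l) => l' ->; last first.
    rewrite (bigD1 i) //= col_mxEd mxE eqxx rmorph1 mul1r ri pi rmorph1 subrr add0r.
    by rewrite big1 // => j /negPf ji; rewrite col_mxEd mxE ji rmorph0 mul0r.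
  have XlX : X`_l' \in X by rewrite mem_nth.
  have [d homXl] := formsX XlX.
  have : evalmp iota r X`_l' = 0.
    by rewrite (evalmp_homog _ _ _ homXl) (eqP (Xu _ XlX)) mulr0.
  rewrite hE rmorphD /= evalmpC.
  have /andP[_ /allP/(_ _ XlX)/eqP->] := Xp; rewrite rmorph0 add0r => Xr0.
  rewrite -[RHS]Xr0 [RHS]rmorph_sum.
  apply: eq_bigr => j _; rewrite col_mxEu mxE rmorphM rmorphB /= evalmpX evalmpC.
  by rewrite mulrC.
pose e := \row_j (j == i)%:R : 'rV[k]_N.+1.
have -> : map_mx (evalmp idfun p) (col_mx (\matrix_(l, j) h l j) (\row_j (j == i)%:R))
    = col_mx (jacobian idfun X p) e.
  rewrite map_col_mx; congr col_mx; apply/matrixP => l j; rewrite !mxE ?h_deriv //.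
  by rewrite rmorph_nat.
rewrite addn1 ltnS -[leqLHS](nsX Xp) addn1; apply: ltn_rank_col_mx.
apply/submxP => -[M eM]; have : (e *m p^T) 0 0 = 1.
  rewrite mxE (bigD1 i) //= big1 ?addr0 => [|j /negPf ji].
    by rewrite !mxE eqxx mul1r -[RHS]pi mxE.
  by rewrite !mxE ji mul0r.
rewrite eM -mulmxA (_ : _ *m p^T = 0) ?mulmx0 ?mxE => [/eqP|].
  by rewrite eq_sym oner_eq0.
apply/matrixP => l j; rewrite ord1 !mxE.
have XlX : X`_l \in X by rewrite mem_nth.
have [d homXl] := formsX XlX.
have := congr1 (evalmp idfun p) (euler_homog homXl).
rewrite evalmpZ; have /andP[_ /allP/(_ _ XlX)/eqP->] := Xp; rewrite mulr0 => Xp0.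
rewrite -[RHS]Xp0 [RHS]rmorph_sum; apply: eq_bigr => j' _.
by rewrite rmorphM /= evalmpX !mxE mulrC.
Qed.

(** [P] is the center of the place [R] on the model, read in one chart; [centered_coord] transfers
    this to every chart containing [P]. *)
Definition centered (R : K -> k -> Prop) (P : 'rV[k]_N.+1) :=
  exists2 i, P 0 i != 0 /\ u 0 i != 0 &
    forall j, R (u 0 j / u 0 i) (P 0 j / P 0 i).

Section Center.

Variables (R : K -> k -> Prop) (plR : rational_place iota R).

Lemma centered_coord P i : centered R P -> P 0 i != 0 ->
  u 0 i != 0 /\ forall j, R (u 0 j / u 0 i) (P 0 j / P 0 i).
Proof.
move=> [l [Pl0 ul0] Rl] Pi0.
have c0 : P 0 i / P 0 l != 0 by rewrite mulf_neq0 ?invr_eq0.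
have ui0 : u 0 i != 0.
  by have := place_neq0 plR (Rl i) c0; rewrite mulf_eq0 negb_or => /andP[].
split=> // j; have := placeM plR (Rl j) (placeV plR (Rl i) c0).
by rewrite !invf_div !mulrA !divfK.
Qed.

Lemma centeredZ P c : c != 0 -> centered R P -> centered R (c *: P).
Proof.
move=> c0 [i [Pi0 ui0] Ri]; exists i; first by rewrite mxE mulf_neq0.
by move=> j; rewrite !mxE -mulf_div divff // mul1r.
Qed.

Lemma centered_inj P P' : centered R P -> centered R P' ->
  exists2 c, c != 0 & P' = c *: P.
Proof.
move=> cP [i [Pi0' ui0] Ri']; have [l [Pl0 ul0] Rl] := cP.
(* The values of [u_i / u_l] and [u_l / u_i] multiply to 1, so [P_i] is nonzero and the chart [i]
   contains both points. *)
have ratio0 : P 0 i / P 0 l != 0.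
  have := place_fun plR (placeM plR (Rl i) (Ri' l)).
  rewrite mulrA divfK // divff // => /(_ _ (place1 plR)).
  by move=> e; apply: contra_eqN e => /eqP->; rewrite mul0r eq_sym oner_eq0.
have Pi0 : P 0 i != 0 by move: ratio0; rewrite mulf_eq0 negb_or => /andP[].
have [_ Ri] := centered_coord cP Pi0.
exists (P' 0 i / P 0 i); first by rewrite mulf_neq0 ?invr_eq0.
apply/rowP => j; rewrite mxE mulrAC -mulrA (place_fun plR (Ri j) (Ri' j)).
by rewrite mulrC divfK.
Qed.

Lemma exists_center : exists2 P, on_locus idfun X P & centered R P.
Proof.
have [/andP[u0 /allP Xu] _ _] := ffX.
(* A coordinate of minimal valuation, found by successive comparison: when [u_j / u_i] is not
   regular, [j] replaces [i]. *)
have dominant (s : seq 'I_N.+1) : exists2 i, u 0 i != 0 &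
    forall j, j \in s -> exists c, R (u 0 j / u 0 i) c.
  elim: s => [|j s [i ui0 IHs]]; first by have /rV0Pn[i ui0] := u0; exists i.
  have [Rj|] := place_total plR (u 0 j / u 0 i).
    by exists i => // l; rewrite inE => /predU1P[->|/IHs].
  rewrite invf_div => Rij; have [uj0|uj0] := eqVneq (u 0 j) 0.
    exists i => // l; rewrite inE => /predU1P[->|/IHs //].
    by exists 0; rewrite uj0 mul0r; apply: (place0 plR).
  exists j => // l; rewrite inE => /predU1P[->|/IHs[c Rl]].
    by exists 1; rewrite divff //; apply: (place1 plR).
  exists (c * 0); have := placeM plR Rl Rij.
  by rewrite mulrA divfK.
have [i ui0 Ri] := dominant (enum 'I_N.+1).
have [j|c Rc] := fin_all_exists (P := fun j => R (u 0 j / u 0 i)).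
  by apply: Ri; rewrite mem_enum.
have ci : c i = 1.
  by apply: (place_fun plR (Rc i)); rewrite divff //; apply: (place1 plR).
pose P := \row_j c j; have Pi : P 0 i = 1 by rewrite mxE.
have Pi0 : P 0 i != 0 by rewrite Pi oner_eq0.
exists P; last first.
  by exists i => // j; rewrite Pi divr1 mxE.
apply/andP; split; first by apply: contraNneq Pi0 => ->; rewrite mxE.
apply/allP => G GX; have [d homG] := formsX GX; apply/eqP.
apply: (place_fun plR _ (place0 plR)).
have <- : evalmp iota ((u 0 i)^-1 *: u) G = 0.
  by rewrite (evalmp_homog _ _ _ homG) (eqP (Xu G GX)) mulr0.
by apply: (place_evalmp plR) => j; rewrite !mxE mulrC.
Qed.

End Center.

(** By [place_local_value] both places are given by the local ring at [P]. *)
Lemma same_center (R R' : K -> k -> Prop) P :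
  algebraically_dependent iota -> rational_place iota R -> rational_place iota R' ->
  on_locus idfun X P -> centered R P -> centered R' P ->
  forall z c, R z c -> R' z c.
Proof.
move=> dep plR plR' XP cP cP' z c.
have /andP[/rV0Pn[i Pi0] _] := XP.
have reg := proj_regular_specialization XP Pi0.
have [_ Ri] := centered_coord plR cP Pi0; have [_ Ri'] := centered_coord plR' cP' Pi0.
move=> /(place_local_value dep reg plR) /= Rz.
apply/(place_local_value dep reg plR'); first by move=> j; rewrite !mxE mulrC [X in R' _ X]mulrC.
by apply: Rz => j; rewrite !mxE mulrC [X in R _ X]mulrC.
Qed.

Lemma exists_place P : algebraically_dependent iota -> on_locus idfun X P ->
  exists2 R, rational_place iota R & centered R P.
Proof.
move=> dep XP; have /andP[/rV0Pn[i Pi0] _] := XP.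
have reg := proj_regular_specialization XP Pi0.
exists (local_value iota ((u 0 i)^-1 *: u) ((P 0 i)^-1 *: P)).
  exact: local_place.
exists i; first by split=> //; apply: proj_generic_neq0 XP _.
move=> j; have := local_valueP iota ((u 0 i)^-1 *: u) ((P 0 i)^-1 *: P) 'X_j.
by rewrite !evalmpX !mxE ![_^-1 * _]mulrC.
Qed.

End ProjectiveModel.

(** * Places of the Artin-Schreier curve *)

Lemma sum_ord2 (V : nmodType) (g : 'I_2 -> V) : \sum_j g j = g 0 + g 1.
Proof.
by rewrite big_ord_recl big_ord1; congr (_ + g _); apply: val_inj.
Qed.

Lemma coefM_top (R : nzRingType) (f g : {poly R}) m n :
  (size f <= m.+1)%N -> (size g <= n.+1)%N -> (f * g)`_(m + n) = f`_m * g`_n.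
Proof.
move=> fm gn; have lt_m : (m < (m + n).+1)%N by rewrite ltnS leq_addr.
rewrite coefM (bigD1 (Ordinal lt_m)) //= addKn big1 ?addr0 // => i.
rewrite -val_eqE /= neq_ltn => /orP[lt_im|lt_mi].
  rewrite [X in _ * X]nth_default ?mulr0 // (leq_trans gn) //.
  by rewrite ltn_subRL ltn_add2r.
by rewrite nth_default ?mul0r // (leq_trans fm).
Qed.

Definition pt2 (E : fieldType) (a b : E) : 'rV[E]_2 :=
  \row_j (if j == 0 then a else b).

Section ArtinSchreier.

Variables (k K : fieldType) (iota : {rmorphism k -> K}).
Variables (q : nat) (alpha beta : k) (w : 'rV[K]_2).
Hypotheses (q_gt1 : (1 < q)%N) (pchar_q : q%:R = 0 :> k) (alpha0 : alpha != 0).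
Hypothesis ffw : affine_function_field (artin_schreier q alpha beta) iota w.

Local Notation x := (w 0 0).
Local Notation y := (w 0 1).
Local Notation f := (artin_schreier q alpha beta).

Let q_gt0 : (0 < q)%N := ltnW q_gt1.

Lemma evalmp_artin_schreier (E : fieldType) (jota : {rmorphism k -> E}) P :
  evalmp jota P f =
    P 0 1 ^+ q - P 0 1 - (jota alpha * P 0 0 ^+ q.-1 - jota beta).
Proof. by rewrite /f !rmorphB /= evalmpZ !rmorphXn /= !evalmpX evalmpC. Qed.

Lemma artin_schreier_generic : y ^+ q - y = iota alpha * x ^+ q.-1 - iota beta.
Proof.
have [ker _] := ffw; apply/eqP; rewrite -subr_eq0 -evalmp_artin_schreier.
by apply/eqP/ker; exists 1; rewrite mul1r.
Qed.

Lemma artin_schreier_algebraically_dependent : algebraically_dependent iota.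
Proof.
have [_ gen] := ffw; apply: (@integral_algebraically_dependent _ _ _ w q q) => //.
have -> : y ^+ q = iota 1 * x ^+ 0 * y ^+ 1 + (iota alpha * x ^+ q.-1 * y ^+ 0 +
    (iota (- beta) * x ^+ 0 * y ^+ 0 + 0)).
  rewrite -[LHS](subrK y) artin_schreier_generic rmorph1 rmorphN; ring.
apply: XYspanD => //; apply: XYspanD => //; first by rewrite prednK.
by apply: XYspanD => //; apply: XYspan0.
Qed.

(* [x |-> S, y |-> Y S]: total degree becomes the degree in [S], and the leading
   form of a polynomial becomes its leading coefficient. *)
Definition degree_morphism : {rmorphism {mpoly k[2]} -> {poly {poly k}}} :=
  mmap (polyC \o polyC) (fun i => if i == 0 then 'X else 'X%:P * 'X).

Local Notation phi := degree_morphism.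

Lemma degree_morphismX i : phi 'X_i = if i == 0 then 'X else 'X%:P * 'X.
Proof. by rewrite [LHS]mmapX mmap1U. Qed.

Lemma degree_morphismC c : phi c%:MP = c%:P%:P.
Proof. exact: mmapC. Qed.

Lemma degree_morphismZ c G : phi (c *: G) = c%:P%:P * phi G.
Proof. exact: mmapZ. Qed.

(** The leading form of [f] is [y ^ q], which vanishes at [(1, 0)]. Leading forms are
    multiplicative, so those of all multiples of [f] vanish there too: this is the point at
    infinity. *)
Lemma lead_coef_degree_morphism G : evalmp iota w G = 0 ->
  (lead_coef (phi G)).[0] = 0.
Proof.
have [ker _] := ffw => /ker [H ->].
rewrite rmorphM lead_coefM hornerM /= [X in _ * X](_ : _ = 0) ?mulr0 //.
have -> : phi f = ('X ^+ q)%:P * 'X^q - ('X%:P * 'X + (alpha%:P%:P * 'X^(q.-1) - beta%:P%:P)).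
  rewrite !rmorphB /= degree_morphismZ !rmorphXn /= !degree_morphismX /=.
  rewrite degree_morphismC exprMn -rmorphXn /=; ring.
rewrite lead_coefDl; last first.
  rewrite size_polyN size_Cmul ?size_polyXn ?expf_neq0 ?polyX_eq0 //.
  rewrite ltnS (leq_trans (size_polyD _ _)) // geq_max.
  rewrite (leq_trans (size_polyMleq _ _)) /=; last first.
    by rewrite size_polyC size_polyX polyX_eq0 /= addn2.
  rewrite (leq_trans (size_polyD _ _)) // geq_max size_polyN.
  rewrite size_Cmul ?polyC_eq0 // size_polyXn prednK // leqnn /=.
  by rewrite (leq_trans (size_polyC_leq1 _)).
rewrite lead_coefM lead_coefC lead_coefXn mulr1 hornerXn expr0n.
by rewrite gtn_eqF.
Qed.

Lemma generic_x_neq0 : x != 0.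
Proof.
apply/eqP => x0; have := @lead_coef_degree_morphism 'X_0.
rewrite evalmpX x0 => /(_ erefl)/eqP.
by rewrite degree_morphismX /= lead_coefX hornerC oner_eq0.
Qed.

(** * Smoothness at the affine points and at infinity *)

Local Notation v := (y / x).
Local Notation s := (x^-1).

(** The affine equation divided by [x ^+ q]. *)
Lemma artin_schreier_infinity :
  v ^+ q - v * s ^+ q.-1 = iota alpha * s - iota beta * s ^+ q.
Proof.
have x0 := generic_x_neq0.
have -> : v * s ^+ q.-1 = y * s ^+ q by rewrite -mulrA -exprS prednK.
have -> : iota alpha * s = iota alpha * x ^+ q.-1 * s ^+ q.
  have -> : s ^+ q = s * s ^+ q.-1 by rewrite -exprS prednK.
  rewrite -mulrA; congr (_ * _); by rewrite mulrCA -exprMn divff // expr1n mulr1.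
rewrite -mulrBl -artin_schreier_generic exprMn; ring.
Qed.

Let artin_schreier_eq (a b : k) := b ^+ q - b == alpha * a ^+ q.-1 - beta.

(** The derivative of the equation in [y] is [q y ^ (q - 1) - 1 = -1], which never vanishes. *)
Lemma finite_regular_specialization a b : artin_schreier_eq a b ->
  regular_specialization iota w (pt2 a b).
Proof.
move=> /eqP eq_ab; have [ker gen] := ffw; split=> //.
  move=> G /ker[H ->]; rewrite rmorphM /= evalmp_artin_schreier !mxE /=.
  by rewrite eq_ab subrr mulr0.
(* [hx] and [hy] are the difference quotients of the equation between the generic point and
   [(a, b)]. *)
pose hx : {mpoly k[2]} :=
  (- alpha)%:MP * \sum_(i < q.-1) 'X_0 ^+ (q.-1.-1 - i) * a%:MP ^+ i.
pose hy : {mpoly k[2]} := \sum_(i < q) 'X_1 ^+ (q.-1 - i) * b%:MP ^+ i - 1.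
exists 1%N, (\row_j (if j == 0 then hx else hy)); split=> [i|].
  have pow_sub c d j n : w 0 j = c -> c ^+ n - iota d ^+ n =
      evalmp iota w (\sum_(l < n) 'X_j ^+ (n.-1 - l) * d%:MP ^+ l) * (c - iota d).
    move=> <-; rewrite rmorph_sum subrXX mulrC; congr (_ * _).
    by apply: eq_bigr => l _; rewrite rmorphM !rmorphXn /= evalmpX evalmpC.
  rewrite sum_ord2 !mxE /= rmorphM rmorphB rmorph1 /= evalmpC.
  rewrite -mulrA -pow_sub // mulrBl -pow_sub // mul1r rmorphN.
  have := congr1 iota eq_ab; rewrite !rmorphB rmorphM !rmorphXn => eq_ab'.
  have -> : y ^+ q = iota alpha * x ^+ q.-1 - iota beta + y.
    by rewrite -artin_schreier_generic subrK.
  have -> : iota b ^+ q = iota alpha * iota a ^+ q.-1 - iota beta + iota b.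
    by rewrite -eq_ab' subrK.
  ring.
have hy_p : evalmp idfun (pt2 a b) hy = -1.
  rewrite rmorphB rmorph1 rmorph_sum /= (eq_bigr (fun=> b ^+ q.-1)).
    by rewrite sumr_const card_ord -mulr_natl pchar_q mul0r sub0r.
  move=> i _; rewrite rmorphM !rmorphXn /= evalmpX evalmpC mxE /= -exprD subnK //.
  by rewrite -ltnS prednK.
rewrite addn1 ltnS lt0n mxrank_eq0; apply/eqP => /matrixP/(_ 0 1).
by rewrite !mxE /= hy_p => /eqP; rewrite oppr_eq0 oner_eq0.
Qed.

Local Notation r8 := (pt2 v s).

(** Denominators of [G (y / x, 1 / x)] are cleared by [x ^+ D]: the numerator has degree at most
    [D], and its part of degree [D] takes at [(1, 0)] the value of [G] at infinity. All large [D]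
    are allowed so that sums can be formed in one degree. *)
Lemma infinity_numerator G : exists D0, forall D, (D0 <= D)%N -> exists G',
  [/\ evalmp iota w G' = x ^+ D * evalmp iota r8 G, (size (phi G') <= D.+1)%N &
      ((phi G')`_D).[0] = evalmp idfun (pt2 0 0) G].
Proof.
have x0 := generic_x_neq0.
elim/mpoly_ring_ind: G => [c|j|G H [D1 IHG] [D2 IHH]|G H [D1 IHG] [D2 IHH]].
- exists 0%N => D _; exists (c *: 'X_0 ^+ D).
  rewrite evalmpZ degree_morphismZ !rmorphXn /= evalmpX degree_morphismX !evalmpC.
  split; first by rewrite mulrC.
    rewrite (leq_trans (size_polyMleq _ _)) // size_polyXn addnS /=.
    by rewrite -add1n leq_add2r size_polyC_leq1.
  by rewrite coefCM coefXn eqxx mulr1 hornerC.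
- exists 1%N => -[//|D] _; have [->|->] : j = 0 \/ j = 1.
  + by case: j => -[|[|//]] ?; [left|right]; apply: val_inj.
  + exists ('X_1 * 'X_0 ^+ D); rewrite !rmorphM !rmorphXn /= !evalmpX !degree_morphismX !mxE /=.
    rewrite -mulrA -exprS coefCM coefXn eqxx mulr1 hornerX; split=> //.
      by rewrite [in RHS]exprSr mulrACA divff // mulr1 mulrC.
    rewrite (leq_trans (size_polyMleq _ _)) // size_polyXn addnS /=.
    by rewrite -[X in (_ <= X)%N]add1n leq_add2r size_polyC_leq1.
  exists ('X_0 ^+ D); rewrite !rmorphXn /= !evalmpX !degree_morphismX !mxE /=.
  by rewrite size_polyXn coefXn gtn_eqF // horner0 exprSr mulfK.
- exists (maxn D1 D2) => D; rewrite geq_max => /andP[/IHG[G' [eG sG cG]] /IHH[H' [eH sH cH]]].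
  exists (G' + H'); rewrite !rmorphD /= coefD hornerD eG eH cG cH mulrDr; split=> //.
  by rewrite (leq_trans (size_polyD _ _)) // geq_max sG.
exists (D1 + D2)%N => D leD; have [G' [eG sG cG]] := IHG _ (leqnn _).
have leD1 : (D1 <= D)%N by rewrite (leq_trans _ leD) ?leq_addr.
have [|H' [eH sH cH]] := IHH (D - D1)%N; first by rewrite leq_subRL.
exists (G' * H'); rewrite !rmorphM /= eG eH.
have {2 3 4}-> : D = (D1 + (D - D1))%N by rewrite subnKC.
rewrite coefM_top // hornerM cG cH exprD mulrACA; split=> //.
rewrite (leq_trans (size_polyMleq _ _)) // -subn1 leq_subLR add1n -addnS -addSn.
exact: leq_add.
Qed.

(** From [x = s^-1] and [y = v / s]; it serves to show that [v] and [s] generate [K]. *)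
Lemma infinity_denominator G : exists D0, forall D, (D0 <= D)%N ->
  exists G', evalmp iota r8 G' = s ^+ D * evalmp iota w G.
Proof.
have x0 := generic_x_neq0.
elim/mpoly_ring_ind: G => [c|j|G H [D1 IHG] [D2 IHH]|G H [D1 IHG] [D2 IHH]].
- exists 0%N => D _; exists (c *: 'X_1 ^+ D).
  by rewrite evalmpZ rmorphXn /= evalmpX evalmpC mxE mulrC.
- exists 1%N => -[//|D] _; have [->|->] : j = 0 \/ j = 1.
  + by case: j => -[|[|//]] ?; [left|right]; apply: val_inj.
  + by exists ('X_1 ^+ D); rewrite rmorphXn /= !evalmpX mxE exprSr divfK.
  exists ('X_0 * 'X_1 ^+ D); rewrite rmorphM rmorphXn /= !evalmpX !mxE /=.
  by rewrite -mulrA -exprS mulrC.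
- exists (maxn D1 D2) => D; rewrite geq_max => /andP[/IHG[G' eG] /IHH[H' eH]].
  by exists (G' + H'); rewrite !rmorphD /= eG eH mulrDr.
exists (D1 + D2)%N => D leD; have [G' eG] := IHG _ (leqnn _).
have leD1 : (D1 <= D)%N by rewrite (leq_trans _ leD) ?leq_addr.
have [|H' eH] := IHH (D - D1)%N; first by rewrite leq_subRL.
exists (G' * H'); rewrite !rmorphM /= eG eH mulrACA -exprD.
by rewrite subnKC.
Qed.

(** Up to sign, the equation at infinity has linear part [alpha s] at the origin, and [alpha] is
    nonzero. *)
Lemma infinity_regular_specialization : regular_specialization iota r8 (pt2 0 0).
Proof.
have x0 := generic_x_neq0; have [_ gen] := ffw; split=> [G Gr0|z|].
- have [D /(_ _ (leqnn _))[G' [eG sG cG]]] := infinity_numerator G.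
  have := lead_coef_degree_morphism (G := G'); rewrite eG Gr0 mulr0 => /(_ erefl).
  (* Either the part of degree [D] is zero, or it is the leading form. *)
  rewrite -cG; have [->|cD0] := eqVneq (phi G')`_D 0; first by rewrite horner0.
  suff -> : lead_coef (phi G') = (phi G')`_D by [].
  rewrite lead_coefE; congr (_`_ _); apply/eqP; rewrite eqn_leq -ltnS.
  have lt_D : (D < size (phi G'))%N.
    by rewrite ltnNge; apply: contra cD0 => le; rewrite nth_default.
  by rewrite prednK ?(leq_ltn_trans _ lt_D) // sG -ltnS prednK ?(leq_ltn_trans _ lt_D).
- have [G [H [H0 ->]]] := gen z.
  have [D1 dG] := infinity_denominator G; have [D2 dH] := infinity_denominator H.
  have [G' eG] := dG _ (leq_maxl D1 D2); have [H' eH] := dH _ (leq_maxr D1 D2).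
  have c0 n : s ^+ n != 0 by rewrite expf_neq0 // invr_eq0.
  by exists G', H'; rewrite eG eH mulf_neq0 // -mulf_div divff // mul1r.
(* The equation at infinity reads [v * v ^ (q - 1) + s * hs = 0], and [hs] has value [- alpha] at
   the origin. *)
pose hs : {mpoly k[2]} :=
  beta%:MP * 'X_1 ^+ q.-1 - 'X_0 * 'X_1 ^+ q.-2 - alpha%:MP.
have [q' eq'] : exists q', q = q'.+2 by case: (q) q_gt1 => [|[|q']] // _; exists q'.
exists 1%N, (\row_j (if j == 0 then 'X_0 ^+ q.-1 else hs)); split=> [i|].
  rewrite sum_ord2 !mxE /= rmorph0 !subr0 !rmorphB !rmorphM !rmorphXn /= !evalmpX.
  rewrite !evalmpC !mxE /= -exprSr prednK //.
  have -> : v ^+ q = iota alpha * s - iota beta * s ^+ q + v * s ^+ q.-1.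
    by rewrite -artin_schreier_infinity subrK.
  rewrite eq' /= exprS [s ^+ q'.+1]exprS; ring.
rewrite addn1 ltnS lt0n mxrank_eq0; apply/eqP => /matrixP/(_ 0 1).
rewrite !mxE /= !rmorphB !rmorphM !rmorphXn /= !evalmpX !evalmpC !mxE /= mul0r.
rewrite eq' /= exprS mul0r mulr0 subr0 sub0r => /eqP; rewrite oppr_eq0.
by rewrite (negPf alpha0).
Qed.

(* [None] is the point at infinity. *)
Definition as_point (o : option (k * k)) : bool :=
  if o is Some (a, b) then artin_schreier_eq a b else true.

Definition as_centered (R : K -> k -> Prop) (o : option (k * k)) :=
  if o is Some (a, b) then R x a /\ R y b else R v 0 /\ R s 0.

Lemma as_regular_specialization o : as_point o ->
  exists (r : 'rV[K]_2) p, regular_specialization iota r p /\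
    forall R, as_centered R o <-> forall j, R (r 0 j) (p 0 j).
Proof.
have ord2P (Q : 'I_2 -> Prop) : Q 0 /\ Q 1 <-> forall j, Q j.
  split=> [[Q0 Q1] -[[|[|//]] lt_j]|QQ]; last by [].
    by rewrite (_ : Ordinal _ = 0) //; apply: val_inj.
  by rewrite (_ : Ordinal _ = 1) //; apply: val_inj.
case: o => [[a b]|] /=.
  move/finite_regular_specialization=> reg; exists w, (pt2 a b); split=> // R.
  by rewrite -ord2P !mxE.
exists r8, (pt2 0 0); split; first exact: infinity_regular_specialization.
by move=> R; rewrite -ord2P !mxE.
Qed.

Lemma exists_as_place o : as_point o ->
  exists2 R, rational_place iota R & as_centered R o.
Proof.
move=> /as_regular_specialization[r [p [reg cE]]].
exists (local_value iota r p).
  by apply: local_place reg _; apply: artin_schreier_algebraically_dependent.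
by apply/cE => j; have := local_valueP iota r p 'X_j; rewrite !evalmpX.
Qed.

Lemma same_as_center R R' o : rational_place iota R -> rational_place iota R' ->
  as_point o -> as_centered R o -> as_centered R' o -> forall z c, R z c -> R' z c.
Proof.
move=> plR plR' /as_regular_specialization[r [p [reg cE]]] /cE Rr /cE Rr' z c.
have dep := artin_schreier_algebraically_dependent.
move=> /(place_local_value dep reg plR Rr) Rz.
exact/(place_local_value dep reg plR' Rr').
Qed.

Lemma as_centered_inj R o o' : rational_place iota R ->
  as_centered R o -> as_centered R o' -> o = o'.
Proof.
move=> plR; have x0 := generic_x_neq0.
have no_pole a : R x a -> R s 0 -> False.
  move=> Rx Rs; have := placeM plR Rx Rs; rewrite divff // mulr0.
  by move=> /(place_fun plR (place1 plR))/eqP; rewrite oner_eq0.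
case: o o' => [[a b]|] [[a' b']|] //= [R1 R2] [R1' R2'].
- by rewrite (place_fun plR R1 R1') (place_fun plR R2 R2').
- by case: (no_pole a).
by case: (no_pole a').
Qed.

(** If [x] is regular, so is [y], being integral over [k[x]]. If [x] has a pole, [s] has value 0 and
    [v] is regular, being integral over [k[s]]; then [v ^+ q] has value 0, hence so does [v]. *)
Lemma exists_as_center R : rational_place iota R ->
  exists2 o, as_point o & as_centered R o.
Proof.
move=> plR; have RC := placeC plR; have q1_gt0 : (0 < q.-1)%N by rewrite -ltnS prednK.
have no_unit : ~ R 1 0.
  by move=> /(place_fun plR (place1 plR))/eqP; rewrite oner_eq0.
have [[a Rx]|[x0 Rs]] := place_regular_or_pole plR x.
  have Rrhs : R (iota alpha * x ^+ q.-1 - iota beta) (alpha * a ^+ q.-1 - beta).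
    by apply: (placeB plR) => //; apply: (placeM plR) => //; apply: (placeX plR).
  have [[b Ry]|[y0 Rt]] := place_regular_or_pole plR y.
    exists (Some (a, b)) => //=; apply/eqP; apply: (place_fun plR) Rrhs.
    by rewrite -artin_schreier_generic; apply: (placeB plR) => //; apply: (placeX plR).
  case: no_unit.
  (* A pole of [y] is excluded by dividing the equation by [y ^+ q]: 1 becomes a sum of terms of
     value 0. *)
  have -> : 1 = (iota alpha * x ^+ q.-1 - iota beta) * y^-1 ^+ q + y^-1 ^+ q.-1.
    rewrite -artin_schreier_generic mulrBl -exprMn divff // expr1n.
    by rewrite -[in y * _](prednK q_gt0) exprS mulrA divff // mul1r subrK.
  rewrite -[X in R _ X](addr0 0) -[X in R _ (X + _)](mulr0 (alpha * a ^+ q.-1 - beta)).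
  have zeroX n : (0 < n)%N -> R (y^-1 ^+ n) 0.
    by move=> n0; have := placeX plR n Rt; rewrite expr0n gtn_eqF.
  by apply: (placeD plR); [apply: (placeM plR) => // | ]; apply: zeroX.
have sX n : (0 < n)%N -> R (s ^+ n) 0.
  by move=> n0; have := placeX plR n Rs; rewrite expr0n gtn_eqF.
have Rrhs : R (iota alpha * s - iota beta * s ^+ q) 0.
  have -> : 0 = alpha * 0 - beta * 0 :> k by rewrite !mulr0 subr0.
  by apply: (placeB plR); apply: (placeM plR) => //; apply: sX.
exists None => //=; split=> //.
have [[c Rv]|[v0 Rt]] := place_regular_or_pole plR v.
  have : R (v ^+ q) 0.
    have -> : v ^+ q = iota alpha * s - iota beta * s ^+ q + v * s ^+ q.-1.
      by rewrite -artin_schreier_infinity subrK.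
    rewrite -[X in R _ X](addr0 0); apply: (placeD plR) => //.
    by rewrite -(mulr0 c); apply: (placeM plR) => //; apply: sX.
  move=> /(place_fun plR (placeX plR q Rv))/eqP; rewrite expf_eq0 => /andP[_ /eqP c0].
  by rewrite -c0.
have tX n : (0 < n)%N -> R (v^-1 ^+ n) 0.
  by move=> n0; have := placeX plR n Rt; rewrite expr0n gtn_eqF.
case: no_unit.
have -> : 1 = (iota alpha * s - iota beta * s ^+ q) * v^-1 ^+ q + v^-1 ^+ q.-1 * s ^+ q.-1.
  rewrite -artin_schreier_infinity mulrBl -exprMn divff // expr1n.
  have -> : v^-1 ^+ q = v^-1 * v^-1 ^+ q.-1 by rewrite -exprS prednK.
  by rewrite mulrACA divff // mul1r [s ^+ _ * _]mulrC subrK.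
rewrite -[X in R _ X](addr0 0) -[X in R _ (X + _)](mulr0 0) -[X in R _ (_ + X)](mulr0 0).
by apply: (placeD plR); apply: (placeM plR) => //; [apply: tX | apply: tX | apply: sX].
Qed.

End ArtinSchreier.

(** * Counting points *)

(** Points of the two models correspond through places, which are only known to exist; a relation
    therefore stands in for a bijection. *)
Lemma eq_card_relation (S T : finType) (A : {set S}) (B : {set T})
    (rel : S -> T -> Prop) :
  (forall a, a \in A -> exists2 b, b \in B & rel a b) ->
  (forall b, b \in B -> exists2 a, a \in A & rel a b) ->
  (forall a b b', a \in A -> b \in B -> b' \in B -> rel a b -> rel a b' -> b = b') ->
  (forall a a' b, a \in A -> a' \in A -> b \in B -> rel a b -> rel a' b -> a = a') ->
  #|A| = #|B|.
Proof.
have half (S' T' : finType) (A' : {set S'}) (B' : {set T'}) (rel' : S' -> T' -> Prop) :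
    (forall a, a \in A' -> exists2 b, b \in B' & rel' a b) ->
    (forall a a' b, a \in A' -> a' \in A' -> b \in B' -> rel' a b -> rel' a' b -> a = a') ->
    (#|A'| <= #|B'|)%N.
  move=> tot inj; have [A'0|[a0 A'a0]] := set_0Vmem A'; first by rewrite A'0 cards0.
  (* [b0] is the default value of the choice function outside [A']. *)
  have [b0 _ _] := tot a0 A'a0.
  have [a|g gP] := fin_all_exists (P := fun a b => a \in A' -> b \in B' /\ rel' a b).
    by have [/tot[b ? ?]|] := boolP (a \in A'); [exists b | exists b0].
  rewrite -(@card_in_imset _ _ g A') => [|a a' A'a A'a' e].
    by apply: subset_leq_card; apply/subsetP => _ /imsetP[a /gP[? _] ->].
  have [B'g r] := gP _ A'a; have [_ r'] := gP _ A'a'.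
  by apply: inj (B'g) _ _; rewrite // e.
move=> totA totB injB injA; apply/eqP; rewrite eqn_leq; apply/andP; split.
  exact: half totA injA.
by apply: (half _ _ _ _ (fun b a => rel a b)) => // b b' a Bb Bb' Aa; exact: injB.
Qed.

Section PointCount.

Variables (k : finFieldType) (q : nat) (alpha beta : k).
Hypotheses (q_gt1 : (1 < q)%N) (pchar_q : q%:R = 0 :> k) (alpha0 : alpha != 0).
Variables (N : nat) (X : seq {mpoly k[N.+1]}).

Definition affine_points : {set k * k} :=
  [set ab | ab.2 ^+ q - ab.2 == alpha * ab.1 ^+ q.-1 - beta].

(** A point of [X] and a point of the Artin-Schreier curve are matched when some place is centered
    at both; the extra point is [None], at infinity. *)
Lemma card_rational_points :
  nonsingular_projective_model (artin_schreier q alpha beta) X ->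
  #|rational_points X| = #|affine_points|.+1.
Proof.
move=> [formsX nsX [K [iota [w [u [ffw ffX]]]]]].
pose B := [set o | as_point q alpha beta o].
have -> : #|affine_points|.+1 = #|B|.
  have -> : B = None |: [set Some ab | ab in affine_points].
    apply/setP => -[ab|]; last by rewrite !inE.
    rewrite !inE /= mem_imset; last by move=> ? ? [].
    by case: ab => a b; rewrite inE.
  rewrite cardsU1 card_imset; last by move=> ? ? [].
  by rewrite (_ : _ \in _ = false) //; apply/imsetP => -[].
have dep := artin_schreier_algebraically_dependent q_gt1 ffw.
pose rel M o := exists2 R, rational_place iota R &
  (exists P, [/\ on_locus idfun X P, M = <<P>>%MS & centered u R P]) /\ as_centered w R o.
(* Rational points are lines, so the representative chosen on a line must not matter. *)
have center_line R P P' : rational_place iota R -> on_locus idfun X P ->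
    on_locus idfun X P' -> <<P>>%MS = <<P'>>%MS -> centered u R P -> centered u R P'.
  move=> plR XP /andP[P'0 _] eqP cP.
  have /sub_rVP[c eP'] : (P' <= P)%MS by rewrite -(genmxE P) eqP genmxE.
  by rewrite eP'; apply: centeredZ => //; apply: contraNneq P'0 => c0; rewrite eP' c0 scale0r.
apply: (eq_card_relation (rel := rel)) => [M|o|M o o'|M M' o].
- case/imsetP => P; rewrite inE => XP ->.
  have [R plR cP] := exists_place formsX nsX ffX dep XP.
  have [o oP co] := exists_as_center q_gt1 alpha0 ffw plR.
  by exists o; rewrite ?inE //; exists R => //; split=> //; exists P.
- rewrite inE => /(exists_as_place q_gt1 pchar_q alpha0 ffw)[R plR co].
  have [P XP cP] := exists_center formsX ffX plR.
  exists <<P>>%MS; first by apply/imsetP; exists P; rewrite ?inE.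
  by exists R => //; split=> //; exists P.
- move=> _ _ _ [R plR [[P [XP -> cP] co]]] [R' plR' [[P' [XP' eqP cP'] co']]].
  have {}cP' := center_line _ _ _ plR' XP' XP (esym eqP) cP'.
  have sRR' := same_center formsX nsX ffX dep plR plR' XP cP cP'.
  have {}co : as_centered w R' o.
    by case: (o) co => [[a b]|] [/sRR' ? /sRR'].
  exact: (as_centered_inj q_gt1 alpha0 ffw plR' co co').
move=> _ _; rewrite inE => op [R plR [[P [XP -> cP] co]]] [R' plR' [[P' [XP' -> cP'] co']]].
have sRR' := same_as_center q_gt1 pchar_q alpha0 ffw plR plR' op co co'.
have {}cP : centered u R' P.
  by case: cP => i Pi Ri; exists i => // j; apply: sRR'.
have [c c0 ->] := centered_inj plR' cP cP'.
by apply/esym/genmxP/eqmxP/eqmx_scale.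
Qed.

End PointCount.

(** * Norm and trace *)

Section NormTraceCount.

Variables (F : finFieldType) (L : fieldExtType F).
Local Notation FL := (finvect_type L).
Local Notation q := #|F|.

Lemma frobenius_generator : {sigma : gal_of {:FL} |
  generator 'Gal({:FL} / 1) sigma & forall z : FL, sigma z = z ^+ q}.
Proof.
have [sigma gen sE] := finField_galois_generator (sub1v {:FL}%AS).
exists sigma => // z; rewrite sE ?memvf //.
by rewrite dimv1 expn1.
Qed.

Lemma frobenius_fixed (z : FL) : (z ^+ q == z) = (z \in 1%VS).
Proof. by rewrite (Fermat's_little_theorem 1%AS) dimv1 expn1. Qed.

Lemma card_frobenius_fixed : #|[set z : FL | z ^+ q == z]| = q.
Proof.
transitivity #|(1%VS : {vspace FL})|; last exact: (@card_vspace1 F FL (Falgebra.class (FL : falgType F))).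
by apply: eq_card => z; rewrite inE frobenius_fixed.
Qed.

(** Hilbert's theorem 90 for the Frobenius [sigma], as [x / sigma x = x^-1 ^+ q.-1]. *)
Lemma normF_eq1P (z : FL) :
  reflect (exists2 x : FL, x != 0 & z = x ^+ q.-1) (normF z == 1).
Proof.
have q_gt0 : (0 < q)%N by apply/card_gt0P; exists 0.
have [sigma gen sE] := frobenius_generator.
have sE' (x : FL) : x != 0 -> x / sigma x = x^-1 ^+ q.-1.
  move=> x0; rewrite sE -{1}(prednK q_gt0) exprS invfM mulrA divff // mul1r.
  by rewrite exprVn.
apply: (iffP (Hilbert's_theorem_90 gen (memvf z))) => [[x [_ x0] ->]|[x x0 ->]].
  by exists x^-1; rewrite ?invr_eq0 ?sE'.
by exists x^-1; rewrite ?memvf ?invr_eq0 ?sE' ?invr_eq0 ?invrK.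
Qed.

(** Additive Hilbert 90 by dimensions: [y ^+ q - y] lies in the kernel of the trace, this map of [y]
    has the line [1%VS] as kernel, and [beta] shows that the trace has rank at least 1. *)
Lemma traceF_eq0P (beta z : FL) : traceF beta != 0 ->
  reflect (exists y : FL, z = y ^+ q - y) (traceF z == 0).
Proof.
move=> trace_beta; have [sigma gen sE] := frobenius_generator.
pose wp : 'End(FL) := (gal_repr sigma : 'End(FL)) - \1%VF.
pose tr : 'End(FL) := \sum_(x in 'Gal({:FL} / 1)%g) (gal_repr x : 'End(FL)).
have wpE y : wp y = y ^+ q - y by rewrite add_lfunE opp_lfunE id_lfunE sE.
have trE y : tr y = traceF y by rewrite sum_lfunE.
have galsigma : sigma \in 'Gal({:FL} / 1)%g by rewrite (eqP gen) cycle_id.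
have sub : (limg wp <= lker tr)%VS.
  apply/subvP => _ /memv_imgP[y _ ->]; rewrite memv_ker trE wpE /traceF raddfB /=.
  by rewrite -sE galTrace_gal ?memvf // subrr.
have ker_wp : lker wp = 1%VS.
  by apply/vspaceP => y; rewrite memv_ker wpE subr_eq0 frobenius_fixed.
have dim_wp := limg_ker_dim wp fullv; have dim_tr := limg_ker_dim tr fullv.
rewrite !capfv in dim_wp dim_tr.
have img_tr : (0 < \dim (limg tr))%N.
  rewrite lt0n dimv_eq0; apply: contraNneq trace_beta => tr0.
  by rewrite -trE -memv0 -tr0 memv_img ?memvf.
have eq_sub : limg wp = lker tr.
  apply/eqP; rewrite eqEdim sub /= -(leq_add2l (\dim (lker wp))) dim_wp -dim_tr.
  by rewrite ker_wp dimv1 addnC leq_add2l.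
rewrite -trE -memv_ker -eq_sub; apply: (iffP memv_imgP) => [[y _ ->]|[y ->]].
  by exists y; rewrite wpE.
by exists y; rewrite ?memvf ?wpE.
Qed.

(** The points are grouped by [z = alpha x ^ (q - 1)]. The fibre over [z] is the product of a coset
    [x0 F^*] and a translate [y0 + F], where [F] is the fixed field of the Frobenius. *)
Lemma card_affine_points (a b : F) (alpha beta : FL) : a != 0 -> b != 0 ->
  normF alpha = a%:A -> traceF beta = b%:A ->
  #|affine_points q alpha beta| = (count_norm_trace L a b * (q * q.-1))%N.
Proof.
move=> a0 b0 norm_alpha trace_beta.
have q_gt1 : (1 < q)%N := finNzRing_gt1 F.
have q1_gt0 : (0 < q.-1)%N by rewrite -ltnS prednK // ltnW.
have algA_eq0 (c : F) : (c%:A == 0 :> FL) = (c == 0) by rewrite scaler_eq0 oner_eq0 orbF.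
have alpha0 : alpha != 0.
  by rewrite -(galNorm_eq0 1 {:FL}) [galNorm _ _ _]norm_alpha algA_eq0.
have tr0 : traceF beta != 0 by rewrite trace_beta algA_eq0.
have traceB (y z : FL) : traceF (y - z) = traceF y - traceF z by rewrite /traceF raddfB.
have normM (y z : FL) : normF (y * z) = normF y * normF z by rewrite /normF galNormM.
rewrite /count_norm_trace; set S := [set z | _].
pose g (xy : FL * FL) : FL := alpha * xy.1 ^+ q.-1.
rewrite -sum1_card (partition_big g (mem S)) /= => [|[x y]]; last first.
  rewrite !inE /g /= => /eqP eq_xy.
  have tr_z : traceF (alpha * x ^+ q.-1) = b%:A.
    apply/eqP; rewrite -trace_beta -subr_eq0 -traceB; apply/(traceF_eq0P _ tr0).
    by exists y.
  rewrite tr_z eqxx andbT normM norm_alpha.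
  suff /normF_eq1P/eqP-> : exists2 x' : FL, x' != 0 & x ^+ q.-1 = x' ^+ q.-1 by rewrite mulr1.
  (* [x = 0] would give trace 0 instead of [b]. *)
  exists x => //; apply/eqP => x0; move/eqP: tr_z.
  rewrite x0 expr0n gtn_eqF // mulr0.
  by rewrite /traceF raddf0 eq_sym algA_eq0 (negPf b0).
rewrite -sum_nat_const; apply: eq_bigr => z; rewrite inE => /andP[/eqP norm_z /eqP tr_z].
have /normF_eq1P[x0 x0_neq0 def_x0] : normF (z / alpha) == 1.
  apply/eqP/(mulIf (_ : normF alpha != 0)); first by rewrite norm_alpha algA_eq0.
  by rewrite -normM divfK // mul1r norm_z.
have /(traceF_eq0P _ tr0)[y0 def_y0] : traceF (z - beta) == 0.
  by rewrite traceB tr_z trace_beta subrr.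
pose fixed := [set c : FL | c ^+ q == c].
have card_x : #|[set x0 * c | c in fixed :\ 0]| = q.-1.
  rewrite card_imset; last exact: mulfI.
  rewrite -[in RHS]card_frobenius_fixed (cardsD1 0 fixed) inE.
  by rewrite expr0n gtn_eqF ?eqxx // ltnW.
have card_y : #|[set y0 + c | c in fixed]| = q.
  by rewrite card_imset ?card_frobenius_fixed //; apply: addrI.
have frobB (y z' : FL) : (y - z') ^+ q = y ^+ q - z' ^+ q.
  by have [sigma _ sE] := frobenius_generator; rewrite -!sE raddfB.
have fixedX (c : FL) : c != 0 -> (c ^+ q == c) = (c ^+ q.-1 == 1).
  by move=> c0; rewrite -[in LHS](prednK (ltnW q_gt1)) exprS -{3}[c]mulr1 (inj_eq (mulfI c0)).
have x0q : x0 ^+ q.-1 != 0 by rewrite expf_neq0.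
have mem_x x : (x \in [set x0 * c | c in fixed :\ 0]) = (alpha * x ^+ q.-1 == z).
  have -> : (alpha * x ^+ q.-1 == z) = (x ^+ q.-1 == x0 ^+ q.-1).
    have az : alpha * (z / alpha) = z by rewrite mulrC divfK.
    by rewrite -def_x0 -[in LHS]az (inj_eq (mulfI alpha0)).
  apply/imsetP/eqP => [[c] | eq_x].
    rewrite !inE => /andP[c0]; rewrite fixedX // => /eqP c1 ->.
    by rewrite exprMn c1 mulr1.
  have x_neq0 : x != 0.
    by apply: contraNneq x0q => x_eq0; rewrite -eq_x x_eq0 expr0n gtn_eqF.
  exists (x / x0); last by rewrite mulrC divfK.
  have c0 : x / x0 != 0 by rewrite mulf_neq0 ?invr_eq0.
  by rewrite !inE c0 fixedX // exprMn exprVn eq_x divff ?eqxx.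
have mem_y y : (y \in [set y0 + c | c in fixed]) = (y ^+ q - y == z - beta).
  have -> : (y ^+ q - y == z - beta) = ((y - y0) ^+ q == y - y0).
    rewrite frobB def_y0 -subr_eq0 -[RHS]subr_eq0; congr (_ == 0).
    ring.
  apply/imsetP/idP => [[c c_fix ->]|y_fix]; first by move: c_fix; rewrite inE addrC addKr.
  by exists (y - y0); rewrite ?inE // addrC subrK.
rewrite sum1_card mulnC -[in RHS]card_x -[X in (_ * X)%N]card_y -cardsX; apply: eq_card => -[x y].
rewrite in_setX mem_x mem_y unfold_in /= inE /g /= andbC.
by case: eqP => // ->.
Qed.

End NormTraceCount.

Theorem theorem2p1 (q n : nat) (F : finFieldType) (L : fieldExtType F)
    (card_F : #|F| = q) (dim_L : \dim {:L} = n) (n_ge2 : (2 <= n)%N)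
    (a b : F) (a_neq0 : a != 0) (b_neq0 : b != 0)
    (alpha beta : finvect_type L)
    (norm_alpha : normF alpha = a%:A) (trace_beta : traceF beta = b%:A)
    (N : nat) (X : seq {mpoly (finvect_type L)[N.+1]})
    (X_model : nonsingular_projective_model (artin_schreier q alpha beta) X) :
  (count_norm_trace L a b)%:R =
    (#|rational_points X|%:R - 1) / (q%:R * (q%:R - 1)) :> rat.
Proof.
have q_gt1 : (1 < q)%N by rewrite -card_F finNzRing_gt1.
have pchar_q : q%:R = 0 :> finvect_type L.
  have qF : q%:R = 0 :> F by rewrite -card_F -FinRing.zmodXgE -cardsT expg_cardG ?inE.
  by rewrite -scaler_nat qF scale0r.
have alpha0 : alpha != 0.
  rewrite -(galNorm_eq0 1 fullv) [galNorm _ _ _]norm_alpha scaler_eq0 oner_eq0.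
  by rewrite orbF.
rewrite (card_rational_points q_gt1 pchar_q alpha0 X_model) -natr1 addrK -{1}card_F.
rewrite (card_affine_points a_neq0 b_neq0 norm_alpha trace_beta) card_F.
have q1E : q%:R - 1 = q.-1%:R :> rat by rewrite -subn1 natrB // ltnW.
have den_neq0 : (q * q.-1)%:R != 0 :> rat.
  rewrite Num.Theory.pnatr_eq0 -lt0n muln_gt0 (ltnW q_gt1).
  by rewrite -ltnS prednK // ltnW.
by rewrite q1E -(natrM _ q) (natrM _ (count_norm_trace L a b)) (mulfK den_neq0).
Qed.
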